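(* Let $\mathcal S=\{(x,y,z)\in\mathbb R^3: y=x\text{ or }x=0\text{ or }z=0\}$ and, for $\delta>0$, let $\mathcal S_\delta=\{\mathbf x\in\mathbb R^3:d(\mathbf x,\mathcal S)\ge\delta\}$. Let $\Theta_{\mathrm{ad}}\subset\mathbb R^3$ be a compact set of admissible parameter values and let $\theta_i=(\sigma_i,\rho_i,\beta_i)\in\Theta_{\mathrm{ad}}$, $i=1,2$, be two parameter vectors for the Lorenz system $\dot x=\sigma(y-x)$, $\dot y=x(\rho-z)-y$, $\dot z=xy-\beta z$. Assume that corresponding trajectories $X_i(\cdot)=(x_i(\cdot),y_i(\cdot),z_i(\cdot))$, $i=1,2$, belong to $\mathcal S_\delta$ for all $t\in\mathcal I$ and satisfy $\sup_{t\in\mathcal I}\|X_i(t)\|\le\mathfrak K$, where $\mathcal I\subset\mathbb R$ is any nontrivial interval if both trajectories $X_i(\cdot)$ lie on the global attractor, or else $\mathcal I$ contains $[t_0,\infty)$ for some $t_0>0$. Then there exists a constant $C_{\delta,\Theta_{\mathrm{ad}}}>0$, depending on the parameter vectors and trajectories only through $\delta$, $\Theta_{\mathrm{ad}}$ and the bound $\mathfrak K$, such that $$\|\theta_1-\theta_2\|_{\mathbb R^3}\le C_{\delta,\Theta_{\mathrm{ad}}}\,\|x_1-x_2\|_{L^\infty(\mathcal I)} .$$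
   Context: $d(\cdot,\mathcal S)$ is Euclidean distance. $\mathfrak K>0$ is a fixed constant; it is a standing assumption that all Lorenz trajectories considered, with parameters in the compact admissible set, are bounded in norm by $\mathfrak K$ on $\mathcal I$. The global attractor of the Lorenz system for a given parameter vector (with $\sigma,\beta>0$) is the compact invariant set attracting all bounded sets, consisting of points on complete (defined for all $t\in\mathbb R$) bounded trajectories; each $X_i$ refers to the attractor of its own parameter vector $\theta_i$.
   Formalization: All parameter vectors in Θ_ad are assumed to have σ>0 and β>0 (with σ=0 the claim fails: equilibria with equal x and different ρ); the constant C may depend on the interval I. *)

(* Defs.v *)
From HB Require Import structures.
From mathcomp Require Import all_boot all_order all_algebra.
From mathcomp Require Import all_classical all_reals all_analysis.

Set Implicit Arguments.
Unset Strict Implicit.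
Unset Printing Implicit Defensive.

Import Order.TTheory GRing.Theory Num.Theory.
Import numFieldNormedType.Exports.

Local Open Scope classical_set_scope.
Local Open Scope ring_scope.

Definition vec3 (R : realType) (a b c : R) : 'rV[R]_3 :=
  \row_(i < 3) [:: a; b; c]`_i.

(* The library norm on ['rV[R]_3] is the max norm, hence a separate Euclidean
   one.  Topological notions ([compact], [bounded_set], [-->]) are unaffected. *)
Definition enorm (R : realType) (p : 'rV[R]_3) : R :=
  Num.sqrt (\sum_(i < 3) p 0 i ^+ 2).

Definition edistance (R : realType) (p : 'rV[R]_3) (B : set 'rV[R]_3) : R :=
  inf [set enorm (p - q) | q in B].

(* Parameter vectors are (sigma, rho, beta); states are (x, y, z). *)
Definition sigma (R : realType) (theta : 'rV[R]_3) : R := theta 0 0.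
Definition rho (R : realType) (theta : 'rV[R]_3) : R := theta 0 1.
Definition beta (R : realType) (theta : 'rV[R]_3) : R := theta 0 2.
Definition xcoord (R : realType) (p : 'rV[R]_3) : R := p 0 0.
Definition ycoord (R : realType) (p : 'rV[R]_3) : R := p 0 1.
Definition zcoord (R : realType) (p : 'rV[R]_3) : R := p 0 2.

Definition lorenz_field (R : realType) (theta p : 'rV[R]_3) : 'rV[R]_3 :=
  let x := xcoord p in let y := ycoord p in let z := zcoord p in
  vec3 (sigma theta * (y - x))
       (x * (rho theta - z) - y)
       (x * y - beta theta * z).

(* The difference quotient is restricted to [I], so the derivative is one-sided
   at endpoints of [I] and values of [X] outside [I] are irrelevant. *)
Definition lorenz_trajectory (R : realType) (theta : 'rV[R]_3) (I : set R)
    (X : R -> 'rV[R]_3) : Prop :=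
  forall t, I t ->
    (fun s => (s - t)^-1 *: (X s - X t)) @ within I t^'
      --> lorenz_field theta (X t).

(* The image S(t)B of [B] under the solution semiflow, for 0 <= t. *)
Definition flow_image (R : realType) (theta : 'rV[R]_3) (t : R)
    (B : set 'rV[R]_3) : set 'rV[R]_3 :=
  [set q | exists X, [/\ lorenz_trajectory theta `[0, +oo[ X,
                         B (X 0) & X t = q]].

Definition invariant_set (R : realType) (theta : 'rV[R]_3)
    (A : set 'rV[R]_3) : Prop :=
  forall t, 0 <= t -> flow_image theta t A = A.

(* The Hausdorff semidistance from S(t)B to [A] tends to 0 as t -> +oo. *)
Definition attracts (R : realType) (theta : 'rV[R]_3)
    (A B : set 'rV[R]_3) : Prop :=
  forall eps : R, 0 < eps -> exists2 T : R, 0 <= T &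
    forall t, T <= t -> forall q, flow_image theta t B q ->
      exists2 a, A a & enorm (q - a) < eps.

Definition complete_bounded_trajectory (R : realType) (theta : 'rV[R]_3)
    (X : R -> 'rV[R]_3) : Prop :=
  lorenz_trajectory theta setT X /\ bounded_set (range X).

Definition global_attractor (R : realType) (theta : 'rV[R]_3)
    (A : set 'rV[R]_3) : Prop :=
  [/\ compact A,
      invariant_set theta A,
      forall B : set 'rV[R]_3, bounded_set B -> attracts theta A B &
      forall p, A p ->
        exists2 X, complete_bounded_trajectory theta X & X 0 = p].

Definition lies_on_attractor (R : realType) (theta : 'rV[R]_3) (I : set R)
    (X : R -> 'rV[R]_3) : Prop :=
  exists2 A, global_attractor theta A & forall t, I t -> A (X t).

Definition calS (R : realType) : set 'rV[R]_3 :=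
  [set p | ycoord p = xcoord p \/ xcoord p = 0 \/ zcoord p = 0].

Definition calS_delta (R : realType) (delta : R) : set 'rV[R]_3 :=
  [set p | delta <= edistance p (@calS R)].

(* The L^oo(I) norm is that of the extension of [f] by 0 outside [I]. *)
Definition Linfty_norm (R : realType) (I : set R) (f : R -> R) : \bar R :=
  Lnorm (@lebesgue_measure R) +oo%E (EFin \o (f \_ I)).

Definition nontrivial_interval (R : realType) (I : set R) : Prop :=
  is_interval I /\ exists a b, [/\ a < b, I a & I b].

(* Main.v *)
Require Import Defs.
From HB Require Import structures.
From mathcomp Require Import all_boot all_order all_algebra.
From mathcomp Require Import all_classical all_reals all_analysis.
From mathcomp Require Import ess_sup_inf.
From mathcomp Require Import ring lra.

Set Implicit Arguments.
Unset Strict Implicit.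
Unset Printing Implicit Defensive.

Import Order.TTheory GRing.Theory Num.Theory.
Import numFieldNormedType.Exports.
Local Open Scope classical_set_scope.
Local Open Scope ring_scope.

(* Let X_1, X_2 be the two trajectories, d = X_1 - X_2, and let J be a short
   open subinterval of I.  On J the sup norm of d is controlled by
   |theta_1 - theta_2| + |d(c)|, c being the midpoint.  If no constant worked,
   rescaling d and theta_1 - theta_2 by this quantity and passing to an
   ultrafilter limit would give a nonzero solution (dX, dtheta) of the
   linearised Lorenz system along a trajectory X with dx = 0 on J.

   Eliminating dy and dz, such a solution forces, with v = x'/x, either z to be
   constant or a relation x^2 = v^2 + b v + tau sigma z - d on J.  Two
   differentiations turn the latter into a polynomial identity in v alone; as v
   is not constant, it holds identically, and it makes z and x^2 polynomials in
   v.  The only candidate left by the Lorenz equations is x^2 = -4 (v + f)^2,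
   which contradicts x <> 0. *)

(** * Polynomial identities and derivatives at a point *)

(** The values at 0, 1, -1, 2, -2, 3, -3 form an invertible linear system in the seven
    coefficients. *)
Lemma coef6_eq0 (R : realType) (c0 c1 c2 c3 c4 c5 c6 : R) :
    (forall u : R, c0 + c1 * u + c2 * u ^+ 2 + c3 * u ^+ 3 + c4 * u ^+ 4
       + c5 * u ^+ 5 + c6 * u ^+ 6 = 0) ->
  [/\ c0 = 0, c1 = 0, c2 = 0, c3 = 0 & [/\ c4 = 0, c5 = 0 & c6 = 0]].
Proof.
move=> h; move: (h 0) (h 1) (h (-1)) (h 2) (h (-2)) (h 3) (h (-3)).
by move=> *; split; [..|split]; lra.
Qed.

(** A nonzero affine factor can be cancelled. The coefficients of the product are compared from the
    constant term upward if [l0] is nonzero; if [l0 = 0] they are those of the second factor,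
    shifted by one degree and scaled by [l1]. *)
Lemma coef5_eq0 (R : realType) (l1 l0 c0 c1 c2 c3 c4 c5 : R) :
    l1 != 0 \/ l0 != 0 ->
    (forall u : R, (l1 * u + l0) * (c0 + c1 * u + c2 * u ^+ 2 + c3 * u ^+ 3
       + c4 * u ^+ 4 + c5 * u ^+ 5) = 0) ->
  [/\ c0 = 0, c1 = 0, c2 = 0 & [/\ c3 = 0, c4 = 0 & c5 = 0]].
Proof.
move=> l h.
have [] := @coef6_eq0 R (l0 * c0) (l1 * c0 + l0 * c1) (l1 * c1 + l0 * c2)
  (l1 * c2 + l0 * c3) (l1 * c3 + l0 * c4) (l1 * c4 + l0 * c5) (l1 * c5).
  by move=> u; rewrite -(h u); ring.
move=> e0 e1 e2 e3 [e4 e5 e6].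
case: (eqVneq l0 0) l => [l00|l0n _].
  case=> // l1n.
  have s (p q : R) : l1 != 0 -> l1 * p + l0 * q = 0 -> p = 0.
    by rewrite l00 mul0r addr0 => n /eqP; rewrite mulf_eq0 (negPf n) => /eqP.
  move/(s _ _ l1n): e1 => ->; move/(s _ _ l1n): e2 => ->.
  move/(s _ _ l1n): e3 => ->; move/(s _ _ l1n): e4 => ->.
  move/(s _ _ l1n): e5 => ->; move/eqP: e6.
  by rewrite mulf_eq0 (negPf l1n) => /eqP ->.
have s (p q : R) : p = 0 -> l1 * p + l0 * q = 0 -> q = 0.
  by move=> -> /eqP; rewrite mulr0 add0r mulf_eq0 (negPf l0n) => /eqP.
have c00 : c0 = 0 by apply: (s 0); rewrite ?mulr0 ?add0r.
have c10 := s _ _ c00 e1; have c20 := s _ _ c10 e2; have c30 := s _ _ c20 e3.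
by have c40 := s _ _ c30 e4; have c50 := s _ _ c40 e5.
Qed.

(* A wrapper that keeps type class inference from resolving derivatives. *)
Definition deriv_at (R : realType) (f : R -> R) (t d : R) : Prop :=
  is_derive t 1 f d.

Lemma deriv_at_eq (R : realType) (f : R -> R) (t d d' : R) :
  deriv_at f t d -> d = d' -> deriv_at f t d'.
Proof. by move=> fd <-. Qed.

Lemma deriv_at_continuous (R : realType) (f : R -> R) (t d : R) :
  deriv_at f t d -> {for t, continuous f}.
Proof.
by case=> fd _; apply: differentiable_continuous; apply/derivable1_diffP.
Qed.

(** Differentiation is local, so an identity valid on an open interval may be differentiated there;
    the eliminations below rest on this. *)
Lemma deriv_at_unique_itv (R : realType) (a b t : R) (f g : R -> R) (df dg : R) :
    t \in `]a, b[ -> (forall s, s \in `]a, b[ -> f s = g s) ->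
  deriv_at f t df -> deriv_at g t dg -> df = dg.
Proof.
move=> tab fg [_ <-] [_ <-]; apply: near_eq_derive; rewrite ?oner_neq0//.
near=> s; apply: fg; near: s; exact: near_in_itvoo.
Unshelve. all: by end_near. Qed.

(** A function with a nonzero derivative somewhere takes two distinct values, hence by the
    intermediate value theorem infinitely many, all of them roots of [p]. *)
Lemma poly_eq0_on_nonconstant (R : realType) (a b : R) (v dv : R -> R)
    (p : {poly R}) :
    (forall t, t \in `]a, b[ -> deriv_at v t (dv t)) ->
    (exists2 t, t \in `]a, b[ & dv t != 0) ->
    (forall t, t \in `]a, b[ -> p.[v t] = 0) ->
  p = 0.
Proof.
move=> vd [t0 t0ab dv0] pv.
have [t1 t1ab v1] : exists2 t1, t1 \in `]a, b[ & v t1 != v t0.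
  apply: contrapT => h; move/eqP: dv0; apply.
  apply: (@deriv_at_unique_itv R a b t0 v (cst (v t0))) => //;
    [|exact: vd|exact: is_derive_cst].
  by move=> s sab; apply: contrapT => /eqP n; apply: h; exists s.
wlog t01 : t0 t1 t0ab t1ab v1 {dv0} / t0 < t1.
  move=> W; have : t0 != t1 by apply: contra v1 => /eqP ->.
  rewrite neq_lt => /orP[|] h; first exact: (W t0 t1).
  by apply: (W t1 t0) => //; rewrite eq_sym.
have vc : {within `[t0, t1], continuous v}.
  apply: derivable_within_continuous => s; rewrite in_itv/= => /andP[s0 s1].
  apply: ex_derive; apply: (vd s).
  move: t0ab t1ab; rewrite !in_itv/= => /andP[? _] /andP[_ ?].
  by apply/andP; split; [apply: lt_le_trans s0|apply: le_lt_trans s1 _].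
apply/eqP/negP => /negP p0.
set n := size p.
(* The [w i] with [i <= n] are [n.+1] distinct points between [v t0] and [v t1], whereas a nonzero
   [p] has fewer than [n = size p] roots. *)
pose w (i : nat) : R := v t0 + i%:R / n.+1%:R * (v t1 - v t0).
have wroot i : (i < n.+1)%N -> root p (w i).
  move=> i_n.
  have l0 : 0 <= i%:R / n.+1%:R :> R by rewrite divr_ge0.
  have l1 : i%:R / n.+1%:R <= 1 :> R.
    by rewrite ler_pdivrMr ?ltr0n// mul1r ler_nat ltnW.
  have [|c cab <-] := @IVT R v t0 t1 (w i) (ltW t01) vc.
    rewrite /w; set l := _ / _ in l0 l1 *.
    by case: (leP (v t0) (v t1)) => h; apply/andP; split; nra.
  apply/rootP; apply: pv; move: cab t0ab t1ab; rewrite !in_itv/=.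
  move=> /andP[c0 c1] /andP[? _] /andP[_ ?].
  by apply/andP; split; [apply: lt_le_trans c0|apply: le_lt_trans c1 _].
have := @max_poly_roots R p [seq w i | i <- iota 0 n.+1] p0.
rewrite size_map size_iota ltnNge leqnSn => h.
suff : false by []; apply: h.
  by apply/allP => x /mapP[i]; rewrite mem_iota add0n => /andP[_ ?] ->; exact: wroot.
rewrite map_inj_uniq ?iota_uniq// => i j; rewrite /w => /addrI.
have d0 : v t1 - v t0 != 0 by rewrite subr_eq0.
move/(mulIf d0)/(mulIf _) => H; apply/eqP; rewrite -(eqr_nat R); apply/eqP; apply: H.
by rewrite invr_eq0 pnatr_eq0.
Qed.

Lemma deriv_atD (R : realType) (t : R) (f g : R -> R) (df dg : R) :
    deriv_at f t df -> deriv_at g t dg ->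
  deriv_at (fun s => f s + g s) t (df + dg).
Proof. by move=> fd gd; apply: is_deriveD. Qed.

Lemma deriv_atN (R : realType) (t : R) (f : R -> R) (df : R) :
  deriv_at f t df -> deriv_at (fun s => - f s) t (- df).
Proof. by move=> fd; apply: is_deriveN. Qed.

Lemma deriv_atM (R : realType) (t : R) (f g : R -> R) (df dg : R) :
    deriv_at f t df -> deriv_at g t dg ->
  deriv_at (fun s => f s * g s) t (f t * dg + g t * df).
Proof. by move=> fd gd; apply: is_deriveM. Qed.

Lemma deriv_atX (R : realType) (t : R) (f : R -> R) (n : nat) (df : R) :
  deriv_at f t df -> deriv_at (fun s => f s ^+ n) t (n%:R * f t ^+ n.-1 * df).
Proof.
move=> fd; have -> : (fun s => f s ^+ n) = f ^+ n by rewrite exprfctE.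
exact: is_deriveX.
Qed.

Lemma deriv_atV (R : realType) (t : R) (f : R -> R) (df : R) :
    f t != 0 -> deriv_at f t df ->
  deriv_at (fun s => (f s)^-1) t (- (f t ^- 2 * df)).
Proof.
by move=> f0 fd; apply: deriv_at_eq (is_deriveV f0 fd) _; rewrite scaleNr.
Qed.

Lemma deriv_at_cst (R : realType) (t c : R) : deriv_at (fun=> c) t (0 : R).
Proof. exact: is_derive_cst. Qed.

Ltac derive_tac := repeat first
  [ eassumption | apply: deriv_atD | apply: deriv_atN
  | apply: deriv_atM | apply: deriv_atX | apply: deriv_at_cst ].

(** * Algebraic relations along the reduced Lorenz system *)

(* X = x^2, v = x'/x and Z = sigma z turn the Lorenz system into a polynomial
   one, with s = sigma (rho - 1). *)
Definition reduced_lorenz (R : realType) (a b sigma beta s : R)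
    (v X Z : R -> R) : Prop :=
  forall t, t \in `]a, b[ ->
  [/\ deriv_at v t (s - Z t - (sigma + 1) * v t - v t ^+ 2),
      deriv_at X t (2 * X t * v t),
      deriv_at Z t (X t * (v t + sigma) - beta * Z t) &
      [/\ 0 < X t, v t != 0 & Z t != 0]].

(** If [v'] vanished throughout, its equation would make [Z] constant, so that
    [X * (v + sigma) = beta * Z]. Differentiating this gives [2 * X * v * (v + sigma) = 0], hence
    [v = - sigma] and [beta * Z = 0], which is excluded. *)
Lemma reduced_lorenz_nonconstant (R : realType) (a b sigma beta s : R)
    (v X Z : R -> R) :
    a < b -> 0 < beta -> reduced_lorenz a b sigma beta s v X Z ->
  exists2 t, t \in `]a, b[ & s - Z t - (sigma + 1) * v t - v t ^+ 2 != 0.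
Proof.
move=> ab beta0 H; apply: contrapT => h.
have dv0 t : t \in `]a, b[ -> s - Z t - (sigma + 1) * v t - v t ^+ 2 = 0.
  by move=> tab; apply: contrapT => /eqP n; apply: h; exists t.
have ZE t : t \in `]a, b[ -> Z t = s + - ((sigma + 1) * v t) + - (v t * v t).
  by move=> /dv0; rewrite expr2 => h0; lra.
have Z'0 t : t \in `]a, b[ -> X t * (v t + sigma) - beta * Z t = 0.
  move=> tab; have [vd Xd Zd _] := H t tab; rewrite dv0// in vd.
  apply: (deriv_at_unique_itv tab ZE Zd).
  apply: deriv_at_eq; first by derive_tac.
  by rewrite /=; ring.
have mab : (a + b) / 2 \in `]a, b[ by rewrite in_itv/=; apply/andP; split; lra.
set t := (a + b) / 2 in mab.
have [vd Xd Zd [X0 v0 Z0]] := H t mab; rewrite dv0// in vd.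
rewrite Z'0// in Zd.
have e : X t * 0 + (v t + sigma) * (2 * X t * v t) = 0.
  apply: (@deriv_at_unique_itv R a b t (fun r => X r * (v r + sigma))
     (fun r => beta * Z r)) => //.
  - by move=> r /Z'0 /eqP; rewrite subr_eq0 => /eqP.
  - by apply: deriv_at_eq; [derive_tac|rewrite /=; ring].
  - by apply: deriv_at_eq; [derive_tac|rewrite /=; ring].
have /eqP : (v t + sigma) * (2 * X t * v t) = 0 by rewrite -e mulr0 add0r.
rewrite !mulf_eq0 (negPf v0) (gt_eqF X0) pnatr_eq0/= !orbF => /eqP vs.
have := Z'0 t mab; rewrite vs mulr0 sub0r => /eqP.
by rewrite oppr_eq0 mulf_eq0 (gt_eqF beta0) (negPf Z0).
Qed.

(* Polynomial solutions Z = - W(v), X = Q(v) - tau W(v) of the reduced system: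
   comparing leading coefficients leaves only W of degree 2, for which
   X = - 4 (v + f1)^2 or beta = 0. *)
Lemma reduced_lorenz_polynomial_curve (R : realType)
    (sigma beta s b tau d l1 l0 w3 w2 w1 w0 : R) :
    0 < sigma -> 0 < beta -> l1 != 0 \/ l0 != 0 ->
    let W u := w3 * u ^+ 3 + w2 * u ^+ 2 + w1 * u + w0 in
    let W' u := 3 * w3 * u ^+ 2 + 2 * w2 * u + w1 in
    let f u := s - (sigma + 1) * u - u ^+ 2 + W u in
    let X u := u ^+ 2 + b * u - d - tau * W u in
    let X' u := 2 * u + b - tau * W' u in
    (forall u, (l1 * u + l0) * (X u * (u + sigma) + beta * W u + W' u * f u) = 0) ->
    (forall u, (l1 * u + l0) * (X' u * f u - 2 * u * X u) = 0) ->
  forall u, X u <= 0.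
Proof.
move=> sigma0 beta0 l W W' f X X' EZ EX.
(* The [fi] and [xi] are the coefficients of [f], the value of [v'] on the curve, and of [X]. Up to
   the affine factor, [EZ] and [EX] are the equations for [Z'] and [X'] on the curve. *)
pose f3 := w3; pose f2 : R := w2 - 1; pose f1 := w1 - (sigma + 1); pose f0 := s + w0.
pose x3 : R := - tau * w3; pose x2 : R := 1 - tau * w2; pose x1 : R := b - tau * w1.
pose x0 : R := - d - tau * w0.
have [||e0 e1 e2 [e3 e4 e5]] := @coef5_eq0 R l1 l0
  (sigma * x0 + beta * w0 + w1 * f0)
  (x0 + sigma * x1 + beta * w1 + 2 * w2 * f0 + w1 * f1)
  (x1 + sigma * x2 + beta * w2 + 3 * w3 * f0 + 2 * w2 * f1 + w1 * f2)
  (x2 + sigma * x3 + beta * w3 + 3 * w3 * f1 + 2 * w2 * f2 + w1 * f3)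
  (x3 + 3 * w3 * f2 + 2 * w2 * f3) (3 * w3 * f3) => //.
  by move=> u; rewrite -(EZ u) /X /W' /f /W /f3 /f2 /f1 /f0 /x3 /x2 /x1 /x0; ring.
(* The coefficient of [u ^+ 5] in [EZ] is [3 * w3 ^+ 2]. *)
have w30 : w3 = 0.
  by apply/eqP; rewrite -sqrf_eq0; apply/eqP; move: e5; rewrite /f3 => ?; lra.
have [||g0 g1 g2 [g3 _ _]] := @coef5_eq0 R l1 l0
  (x1 * f0) (2 * x2 * f0 + x1 * f1 - 2 * x0) (2 * x2 * f1 + x1 * f2 - 2 * x1)
  (2 * x2 * f2 - 2 * x2) 0 0 => //.
  move=> u; apply: etrans (EX u).
  by rewrite /X' /X /W' /f /W /f2 /f1 /f0 /x2 /x1 /x0 w30; ring.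
have XE u : X u = x2 * u ^+ 2 + x1 * u + x0.
  by rewrite /X /W w30 /x2 /x1 /x0; ring.
have e3' : x2 + 2 * w2 * f2 = 0.
  by rewrite -[RHS]e3 /x3 /f3 w30; ring.
have e1' := e1.
move=> u; rewrite XE.
(* If the leading coefficient of [X] vanishes, the remaining comparisons make [X] vanish
   identically. *)
have [x20|x20] := eqVneq x2 0.
  have w2n : w2 != 0.
    apply/eqP => w20; move/eqP: x20.
    by rewrite /x2 w20 mulr0 subr0 oner_eq0.
  have f20 : f2 = 0.
    move/eqP: e3'; rewrite x20 add0r mulf_eq0 mulf_eq0 pnatr_eq0 (negPf w2n)/=.
    by move/eqP.
  have x10 : x1 = 0 by move: g2; rewrite x20 f20 => ?; lra.
  have x00 : x0 = 0 by move: g1; rewrite x20 x10 => ?; lra.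
  by rewrite x20 x10 x00 !mul0r !addr0.
(* Otherwise the cubic coefficients fix [f2], [w2] and [x2], and the lower ones of [EX] give
   [X u = - 4 * (u + f1) ^+ 2 - 4 * f0]. *)
have f21 : f2 = 1 by apply: (mulfI x20); lra.
have w22 : w2 = 2 by move: f21; rewrite /f2 => ?; lra.
have x24 : x2 = -4 by move: e3'; rewrite f21 w22 => ?; lra.
have x1E : x1 = - 8 * f1 by move: g2; rewrite f21 x24 => ?; lra.
have x0E : x0 = - 4 * f0 - 4 * f1 ^+ 2 by move: g1; rewrite x24 x1E => ?; lra.
(* The constant term of [EX] leaves two cases. If [f1 = 0], the linear coefficient of [EZ] reduces
   to [beta * (sigma + 1) = 0], which is impossible; if [f0 = 0], [X] is -4 times a square. *)
move/eqP: g0; rewrite mulf_eq0 => /orP[|] /eqP h0.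
  have f10 : f1 = 0 by move: h0; rewrite x1E => ?; lra.
  have w1E : w1 = sigma + 1 by move: f10; rewrite /f1 => ?; lra.
  move: e1'; rewrite f10 w22 w1E h0 x0E f10 expr0n/= => e.
  have : 0 < beta * (sigma + 1) by rewrite mulr_gt0// addr_gt0.
  by lra.
rewrite x24 x1E x0E h0.
rewrite (_ : _ + _ = - (4 * (u + f1) ^+ 2)); last by ring.
by rewrite oppr_le0 mulr_ge0// sqr_ge0.
Qed.

(* Differentiating the relation gives L(v) Z + M(v) = 0 with L affine and M
   cubic; differentiating once more and eliminating Z gives a polynomial
   identity P(v) = 0, which must hold identically, and P(v0) = - l1 M(v0)^2
   at the zero v0 of L forces L to divide M. *)
Lemma reduced_lorenz_no_relation (R : realType) (a b sigma beta s b1 tau d : R)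
    (v X Z : R -> R) :
    a < b -> 0 < sigma -> 0 < beta -> reduced_lorenz a b sigma beta s v X Z ->
    ~ (forall t, t \in `]a, b[ -> X t = v t ^+ 2 + b1 * v t + tau * Z t - d).
Proof.
move=> ab sigma0 beta0 H XE.
have nonconst := reduced_lorenz_nonconstant ab beta0 H.
have vd t : t \in `]a, b[ ->
  deriv_at v t (s - Z t - (sigma + 1) * v t - v t ^+ 2) by case/H.
(* These come from differentiating the relation and using it again to eliminate [X]; [Q (v t)] is
   [X t - tau * Z t], and [M'] is the derivative of [M]. *)
pose l1 : R := tau ^+ 2 - 2 * tau - 2.
pose l0 : R := sigma * tau ^+ 2 - tau * beta - b1.
pose Q u : R := u ^+ 2 + b1 * u - d.
pose M u : R := (2 * u + b1) * (s - (sigma + 1) * u - u ^+ 2)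
  + (sigma * tau + (tau - 2) * u) * Q u.
pose M' u : R := 2 * (s - (sigma + 1) * u - u ^+ 2)
  + (2 * u + b1) * (- (sigma + 1) - 2 * u)
  + (tau - 2) * Q u + (sigma * tau + (tau - 2) * u) * (2 * u + b1).
have MZ t : t \in `]a, b[ -> (l1 * v t + l0) * Z t + M (v t) = 0.
  move=> tab; have [vdt Xdt Zdt _] := H t tab.
  have := deriv_at_unique_itv tab XE Xdt.
  set D := (2 * v t + b1) * (s - Z t - (sigma + 1) * v t - v t ^+ 2)
    + tau * (X t * (v t + sigma) - beta * Z t).
  move/(_ D) => E; have {E} : 2 * X t * v t = D.
    apply: E; apply: deriv_at_eq; first by derive_tac.
    by rewrite /D /=; ring.
  by rewrite /D XE// /M /Q /l1 /l0 => h; lra.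
have MZ' t : t \in `]a, b[ ->
    (l1 * v t + l0) * (X t * (v t + sigma) - beta * Z t)
    + (l1 * Z t + M' (v t)) * (s - Z t - (sigma + 1) * v t - v t ^+ 2) = 0.
  move=> tab; have [vdt Xdt Zdt _] := H t tab.
  set D := LHS.
  apply: (@deriv_at_unique_itv R a b t _ _ D 0 tab MZ); last exact: deriv_at_cst.
  rewrite /M /Q; apply: deriv_at_eq; first by derive_tac.
  by rewrite /D /M' /Q /=; ring.
(* The identity [MZ'] multiplied by [(l1 * u + l0) ^+ 2], with [(l1 * u + l0) * Z] replaced by
   [- M u]. *)
pose P u : R := (l1 * u + l0) ^+ 2 * (((l1 * u + l0) * Q u - tau * M u)
    * (u + sigma) + beta * M u)
  + (M' u * (l1 * u + l0) - l1 * M u)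
    * ((s - (sigma + 1) * u - u ^+ 2) * (l1 * u + l0) + M u).
have Pv t : t \in `]a, b[ -> P (v t) = 0.
  move=> tab; have := MZ' t tab; rewrite XE// -/(Q (v t)) /P.
  have -> : M (v t) = - ((l1 * v t + l0) * Z t).
    by apply/eqP; rewrite -addr_eq0 addrC; apply/eqP; exact: MZ.
  move=> h; transitivity ((l1 * v t + l0) ^+ 2 * 0); last by rewrite mulr0.
  by rewrite -[in RHS]h /Q; ring.
have vanish (p : {poly R}) (F : R -> R) : (forall u, p.[u] = F u) ->
    (forall t, t \in `]a, b[ -> F (v t) = 0) -> forall u, F u = 0.
  move=> pF Fv u; rewrite -pF.
  rewrite (poly_eq0_on_nonconstant vd nonconst (p := p)) ?horner0//.
  by move=> t tab; rewrite pF Fv.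
pose qp : {poly R} := 'X ^+ 2 + b1 *: 'X - d%:P.
pose np : {poly R} := s%:P - (sigma + 1) *: 'X - 'X ^+ 2.
pose mp : {poly R} := (2 *: 'X + b1%:P) * np
  + ((sigma * tau)%:P + (tau - 2) *: 'X) * qp.
pose m'p : {poly R} := 2 *: np
  + (2 *: 'X + b1%:P) * ((- (sigma + 1))%:P - 2 *: 'X)
  + (tau - 2) *: qp + ((sigma * tau)%:P + (tau - 2) *: 'X) * (2 *: 'X + b1%:P).
pose lp : {poly R} := l1 *: 'X + l0%:P.
have qE u : qp.[u] = Q u by rewrite /qp !hornerE.
have nE u : np.[u] = s - (sigma + 1) * u - u ^+ 2 by rewrite /np !hornerE.
have mE u : mp.[u] = M u by rewrite /mp /M !(hornerE, qE, nE).
have m'E u : m'p.[u] = M' u by rewrite /m'p /M' !(hornerE, qE, nE).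
have lE u : lp.[u] = l1 * u + l0 by rewrite /lp !hornerE.
have P0 : forall u, P u = 0.
  apply: (vanish (lp ^+ 2 * ((lp * qp - tau *: mp) * ('X + sigma%:P) + beta *: mp)
    + (m'p * lp - l1 *: mp) * (np * lp + mp))) => // u.
  by rewrite /P !(hornerE, qE, nE, mE, m'E, lE).
(* If both vanished, so would [M] identically; its cubic coefficient [tau - 4] then gives [tau = 4],
   for which [l1 = 6]. *)
have l10 : l1 != 0 \/ l0 != 0.
  have [l10|] := eqVneq l1 0; last by left.
  have [l00|] := eqVneq l0 0; last by right.
  have M0 : forall u, M u = 0.
    apply: (vanish mp) => // t tab.
    by have := MZ t tab; rewrite l10 l00 !(mul0r, add0r).
  have [||_ _ _ [m3 _ _]] := @coef5_eq0 R 0 1 (b1 * s - sigma * tau * d)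
    (2 * s - b1 * (sigma + 1) + sigma * tau * b1 - (tau - 2) * d)
    (- 2 * (sigma + 1) - b1 + sigma * tau + (tau - 2) * b1) (tau - 4) 0 0.
  - by right; rewrite oner_eq0.
  - by move=> u; apply: etrans (M0 u); rewrite /M /Q; ring.
  - by move: l10; rewrite /l1 (_ : tau = 4); [move=> ?; lra|lra].
pose m3 : R := tau - 4.
pose m2 : R := - 2 * (sigma + 1) - b1 + sigma * tau + (tau - 2) * b1.
pose m1 : R := 2 * s - b1 * (sigma + 1) + sigma * tau * b1 - (tau - 2) * d.
pose m0 : R := b1 * s - sigma * tau * d.
have ME u : M u = m3 * u ^+ 3 + m2 * u ^+ 2 + m1 * u + m0.
  by rewrite /M /Q /m3 /m2 /m1 /m0; ring.
have [w3 [w2 [w1 [w0 Mfac]]]] : exists w3 w2 w1 w0 : R, forall u,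
    M u = (l1 * u + l0) * (w3 * u ^+ 3 + w2 * u ^+ 2 + w1 * u + w0).
  have [l1n|l1n] := eqVneq l1 0.
    have l0n : l0 != 0 by case: l10 => //; rewrite l1n eqxx.
    exists (m3 / l0), (m2 / l0), (m1 / l0), (m0 / l0) => u.
    by rewrite ME l1n mul0r add0r; field.
  have Mr : M (- l0 / l1) = 0.
    apply/eqP; rewrite -sqrf_eq0; apply/eqP.
    have := P0 (- l0 / l1); rewrite /P.
    have -> : l1 * (- l0 / l1) + l0 = 0 by field.
    rewrite expr0n/= mul0r mulr0 sub0r add0r mulr0 add0r mulNr -mulrA.
    by move/eqP; rewrite oppr_eq0 mulf_eq0 (negPf l1n) -expr2 => /eqP.
  (* The quotient of [M] by [l1 * u + l0], computed by synthetic division. *)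
  exists 0, (m3 / l1), ((m2 - l0 * (m3 / l1)) / l1),
    ((m1 - l0 * ((m2 - l0 * (m3 / l1)) / l1)) / l1) => u.
  transitivity (M u - M (- l0 / l1)); first by rewrite Mr subr0.
  by rewrite !ME; field.
pose W u : R := w3 * u ^+ 3 + w2 * u ^+ 2 + w1 * u + w0.
(* With [M u = (l1 * u + l0) * W u], [P u] is the cube of the affine factor times the second factor
   here. Keeping one affine factor makes the identity hold at its zero as well. *)
have EZ u : (l1 * u + l0) * ((u ^+ 2 + b1 * u - d - tau * W u) * (u + sigma)
    + beta * W u + (3 * w3 * u ^+ 2 + 2 * w2 * u + w1)
    * (s - (sigma + 1) * u - u ^+ 2 + W u)) = 0.
  have M'fac : M' u = l1 * W u
      + (l1 * u + l0) * (3 * w3 * u ^+ 2 + 2 * w2 * u + w1).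
    have [|_ e1 e2 e3 [e4 _ _]] := @coef6_eq0 R (m0 - l0 * w0)
      (m1 - (l1 * w0 + l0 * w1)) (m2 - (l1 * w1 + l0 * w2))
      (m3 - (l1 * w2 + l0 * w3)) (- (l1 * w3)) 0 0.
      move=> r; transitivity (M r - (l1 * r + l0) * W r).
        by rewrite ME /W; ring.
      by rewrite Mfac subrr.
    transitivity (3 * m3 * u ^+ 2 + 2 * m2 * u + m1).
      by rewrite /M' /Q /m3 /m2 /m1; ring.
    move/eqP: e1; rewrite subr_eq0 => /eqP ->.
    move/eqP: e2; rewrite subr_eq0 => /eqP ->.
    move/eqP: e3; rewrite subr_eq0 => /eqP ->.
    have l1w3 : l1 * w3 = 0 by apply: oppr_inj; rewrite oppr0.
    by rewrite /W; ring: l1w3.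
  have := P0 u; rewrite /P M'fac Mfac -/(W u) -/(Q u) => h.
  apply/eqP; rewrite mulf_eq0; case: eqVneq => //= n.
  apply/eqP; apply: (mulfI (expf_neq0 3 n)); rewrite mulr0 -[RHS]h; ring.
(* Modulo [EZ], the equation for [X'] on the curve [Z = - W] is the differentiated relation with [Z]
   replaced by [- W], which holds by the factorisation of [M]. *)
have EX u : (l1 * u + l0) * ((2 * u + b1 - tau * (3 * w3 * u ^+ 2 + 2 * w2 * u + w1))
      * (s - (sigma + 1) * u - u ^+ 2 + W u)
    - 2 * u * (u ^+ 2 + b1 * u - d - tau * W u)) = 0.
  transitivity ((l1 * u + l0) * (M u - (l1 * u + l0) * W u)); last first.
    by rewrite Mfac subrr mulr0.
  apply/eqP; rewrite -subr_eq0; apply/eqP.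
  rewrite -[RHS](mulr0 (- tau)) -(EZ u) /M /Q /l1 /l0; ring.
(* Where the affine factor is nonzero, [Z t = - W (v t)]: the orbit meets the polynomial curve, on
   which [X] is nonpositive. *)
have [t tab Lt] : exists2 t, t \in `]a, b[ & l1 * v t + l0 != 0.
  apply: contrapT => h.
  have L0 : forall u, l1 * u + l0 = 0.
    apply: (vanish lp) => // t tab; apply: contrapT => /eqP n.
    by apply: h; exists t.
  have l00 : l0 = 0 by have := L0 0; rewrite mulr0 add0r.
  have l1n : l1 = 0 by have := L0 1; rewrite l00 mulr1 addr0.
  by case: l10; rewrite ?l00 ?l1n eqxx.
have ZW : Z t = - W (v t).
  apply: (mulfI Lt); apply/eqP; rewrite mulrN -addr_eq0 -Mfac; apply/eqP.
  exact: MZ.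
have := reduced_lorenz_polynomial_curve sigma0 beta0 l10 EZ EX (v t).
have [_ _ _ [X0 _ _]] := H t tab.
rewrite leNgt => /negP; apply; move: X0; rewrite XE// ZW /W.
by congr (0 < _); ring.
Qed.

(** * The Lorenz system away from [calS] and its linearisation *)

(** The last clause keeps the orbit off the three planes forming [calS]. It makes [v = x'/x]
    meaningful and, for positive [sigma], yields the sign conditions of [reduced_lorenz]. *)
Definition lorenz_on (R : realType) (a b sigma rho beta : R)
    (x y z : R -> R) : Prop :=
  forall t, t \in `]a, b[ ->
  [/\ deriv_at x t (sigma * (y t - x t)),
      deriv_at y t (x t * (rho - z t) - y t),
      deriv_at z t (x t * y t - beta * z t) &
      [/\ x t != 0, y t != x t & z t != 0]].

Lemma lorenz_on_reduced (R : realType) (a b sigma rho beta : R)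
    (x y z : R -> R) :
    0 < sigma -> lorenz_on a b sigma rho beta x y z ->
  reduced_lorenz a b sigma beta (sigma * (rho - 1))
    (fun t => sigma * (y t * (x t)^-1 - 1)) (fun t => x t * x t)
    (fun t => sigma * z t).
Proof.
move=> sigma0 H t tab; have [xd yd zd [x0 yx z0]] := H t tab.
have xVd := deriv_atV x0 xd.
split.
- apply: deriv_at_eq; first by derive_tac.
  by rewrite /=; field.
- apply: deriv_at_eq; first by derive_tac.
  by rewrite /=; field.
- apply: deriv_at_eq; first by derive_tac.
  by rewrite /=; field.
- split; first by rewrite -expr2 exprn_even_gt0.
  + apply: mulf_neq0; first by rewrite gt_eqF.
    rewrite -[X in _ - X](mulfV x0) -mulrBl.
    by rewrite mulf_neq0 ?invr_eq0 ?subr_eq0.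
  + by apply: mulf_neq0 => //; rewrite gt_eqF.
Qed.

(** For constant [Z], the equation for [Z'] makes [X * (v + sigma)] constant. Differentiating it and
    dividing by [X] gives a monic quadratic equation for [v], which a nonconstant [v] cannot
    satisfy. *)
Lemma reduced_lorenz_Z_nonconstant (R : realType) (a b sigma beta s Z0 : R)
    (v X Z : R -> R) :
    a < b -> 0 < beta -> reduced_lorenz a b sigma beta s v X Z ->
  ~ (forall t, t \in `]a, b[ -> Z t = Z0).
Proof.
move=> ab beta0 H ZE.
have nonconst := reduced_lorenz_nonconstant ab beta0 H.
have vd t : t \in `]a, b[ ->
  deriv_at v t (s - Z t - (sigma + 1) * v t - v t ^+ 2) by case/H.
have XE t : t \in `]a, b[ -> X t * (v t + sigma) = beta * Z0.
  move=> tab; have [_ _ Zd _] := H t tab; rewrite -(ZE t tab).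
  have := deriv_at_unique_itv tab ZE Zd (deriv_at_cst t Z0).
  by move/eqP; rewrite subr_eq0 => /eqP.
have p0 : 'X ^+ 2 + (sigma - 1) *: 'X + (s - Z0)%:P = 0 :> {poly R}.
  apply: (poly_eq0_on_nonconstant vd nonconst) => t tab.
  rewrite !hornerE; have [vdt Xd _ [X0 _ _]] := H t tab.
  have Xn : X t != 0 by rewrite gt_eqF.
  apply: (mulfI Xn); rewrite mulr0.
  apply: (deriv_at_unique_itv tab XE _ (deriv_at_cst t _)).
  apply: deriv_at_eq; first by derive_tac.
  by rewrite /= ZE//; ring.
have pE u : u ^+ 2 + (sigma - 1) * u + (s - Z0) = 0.
  by have := congr1 (horner^~ u) p0; rewrite /= !hornerE.
by move: (pE 0) (pE 1) (pE 2) => *; lra.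
Qed.

(* The unknowns ds, dr, db, ey, ez solve the Lorenz system linearised along
   (x, y, z), with vanishing first component. *)
Lemma linearized_lorenz_injective (R : realType)
    (a b sigma rho beta sigma1 beta1 ds dr db : R) (x y z ey ez : R -> R) :
    a < b -> 0 < sigma -> 0 < beta -> 0 < sigma1 -> 0 < beta1 ->
    lorenz_on a b sigma rho beta x y z ->
    (forall t, t \in `]a, b[ ->
      [/\ sigma1 * ey t + ds * (y t - x t) = 0,
          deriv_at ey t (x t * (dr - ez t) - ey t) &
          deriv_at ez t (x t * ey t - beta1 * ez t - db * z t)]) ->
  [/\ ds = 0, dr = 0, db = 0 &
      forall t, t \in `]a, b[ -> ey t = 0 /\ ez t = 0].
Proof.
move=> ab sigma0 beta0 sigma10 beta10 H E.
have G := lorenz_on_reduced sigma0 H.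
have sn : sigma != 0 by rewrite gt_eqF.
have s1n : sigma1 != 0 by rewrite gt_eqF.
have b1n : beta1 != 0 by rewrite gt_eqF.
(* The first equation is algebraic and gives [ey]. Differentiating this formula and comparing with
   the second equation gives [ez]; repeating this with the third gives [rel]. *)
pose k := ds / sigma1.
pose v t := sigma * (y t * (x t)^-1 - 1).
have eyE t : t \in `]a, b[ -> ey t = - k * (y t - x t).
  move=> /E[e _ _]; apply: (mulfI s1n); rewrite /k.
  transitivity (- (ds * (y t - x t))); last by field.
  by apply/eqP; rewrite -addr_eq0; apply/eqP.
have ezE t : t \in `]a, b[ ->
    ez t = dr + k * (rho - 1 - z t - sigma * (y t * (x t)^-1 - 1)).
  move=> tab; have [_ eyd _] := E t tab.
  have [xd yd zd [x0 yx z0]] := H t tab.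
  have e : x t * (dr - ez t) - ey t
      = - k * (x t * (rho - z t) - y t - sigma * (y t - x t)).
    apply: (deriv_at_unique_itv tab eyE eyd).
    apply: deriv_at_eq; first by derive_tac.
    by rewrite /=; ring.
  rewrite eyE// in e.
  apply: (mulfI x0); transitivity (x t * dr - (x t * (dr - ez t)
    - - k * (y t - x t)) + k * (y t - x t)); first by ring.
  by rewrite e; field.
have rel t : t \in `]a, b[ ->
    x t * (- k * (y t - x t)) - beta1 * (dr + k * (rho - 1 - z t - v t)) - db * z t
    = - k * (x t * y t - beta * z t
        + (sigma * (rho - 1) - sigma * z t - (sigma + 1) * v t - v t ^+ 2)).
  move=> tab; have [_ _ ezd] := E t tab; have [vd _ _ _] := G t tab.
  have [xd yd zd [x0 yx z0]] := H t tab.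
  rewrite eyE// ezE// -/(v t) in ezd.
  apply: (deriv_at_unique_itv tab ezE ezd).
  apply: deriv_at_eq; first by derive_tac.
  by rewrite /= /v; ring.
have [k0|kn] := eqVneq k 0; last first.
  (* Dividing [rel] by [k] solves it for [x ^+ 2]; the witnesses are the resulting coefficients in
     [v] and [sigma * z]. *)
  exfalso; apply: (reduced_lorenz_no_relation ab sigma0 beta0 G
    (b1 := sigma + 1 - beta1) (tau := (beta + sigma - beta1 + db / k) / sigma)
    (d := sigma * (rho - 1) - beta1 * (rho - 1) - beta1 * dr / k)) => t tab.
  have := rel t tab; rewrite -/(v t) => e.
  apply: (mulfI kn); apply/eqP; rewrite -subr_eq0; apply/eqP.
  move/eqP: e; rewrite -subr_eq0 => /eqP e; rewrite -[RHS]e; field.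
  by rewrite kn sn.
have ds0 : ds = 0.
  by apply/eqP; move/eqP: k0; rewrite /k mulf_eq0 invr_eq0 (negPf s1n) orbF.
(* For [k = 0], [rel] is affine in [z]; as [z] is not constant, [db] and then [dr] must vanish. *)
have zE t : t \in `]a, b[ -> beta1 * dr + db * z t = 0.
  by move=> tab; have := rel t tab; rewrite k0 => ?; lra.
have [db0|dbn] := eqVneq db 0; last first.
  exfalso; apply: (reduced_lorenz_Z_nonconstant ab beta0 G
    (Z0 := - (sigma * (beta1 * dr) / db))) => t tab /=.
  apply: (mulfI dbn); rewrite -[LHS](addrK (sigma * (beta1 * dr))).
  transitivity (sigma * (beta1 * dr + db * z t) - sigma * (beta1 * dr)).
    by ring.
  by rewrite zE//; field.
have dr0 : dr = 0.
  have mab : (a + b) / 2 \in `]a, b[ by rewrite in_itv/=; apply/andP; split; lra.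
  have /eqP := zE _ mab; rewrite db0 mul0r addr0 mulf_eq0 (negPf b1n)/=.
  by move/eqP.
split=> // t tab; rewrite eyE// ezE// k0 dr0; split; ring.
Qed.

(** * Difference quotients, mean values and the essential supremum *)

Lemma deriv_at_eps (R : realType) (f : R -> R) (t d : R) :
    (forall e, 0 < e -> exists2 r, 0 < r & forall s, s != t -> `|s - t| < r ->
      `|(s - t)^-1 * (f s - f t) - d| < e) ->
  deriv_at f t d.
Proof.
move=> H.
have c : (fun h : R => h^-1 *: ((f \o shift t) (h *: 1) - f t)) @ 0^' --> d.
  apply/cvgrPdist_lt => e /H[r r0 hr].
  exists r => //= h /=; rewrite sub0r normrN => hr' h0.
  rewrite distrC [h%:A]mulr1; have := hr (h + t); rewrite addrK; apply => //.
  by rewrite -subr_eq0 addrK.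
split; first by apply/cvg_ex; exists d.
exact: (cvg_lim _ c).
Qed.

(** A second-order remainder bound identifies the derivative and, unlike differentiability itself,
    survives pointwise limits. *)
Lemma deriv_at_quadratic (R : realType) (f : R -> R) (a b t d M : R) :
    t \in `]a, b[ ->
    (forall s, s \in `]a, b[ ->
      `|f s - f t - (s - t) * d| <= M * (s - t) ^+ 2) ->
  deriv_at f t d.
Proof.
move=> tab H; apply: deriv_at_eps => e e0.
have [r /= r0 hr] := near_in_itvoo tab.
have M0 : 0 < `|M| + 1 by rewrite ltr_wpDl.
exists (Num.min r (e / (`|M| + 1))); first by rewrite lt_min r0 divr_gt0.
move=> s st; rewrite lt_min => /andP[sr se].
have sab : s \in `]a, b[ by apply: hr; rewrite /= distrC.
have st0 : s - t != 0 by rewrite subr_eq0.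
have -> : (s - t)^-1 * (f s - f t) - d
    = (s - t)^-1 * (f s - f t - (s - t) * d) by field.
rewrite normrM normfV mulrC ltr_pdivrMr ?normr_gt0//.
apply: (le_lt_trans (H s sab)).
rewrite -real_normK ?num_real// expr2 mulrA ltr_pM2r ?normr_gt0//.
rewrite ltr_pdivlMr// mulrC in se; apply: le_lt_trans se.
by rewrite ler_wpM2r// (le_trans (ler_norm _))// lerDl.
Qed.

(** The bound on the distance from [c] to [t] replaces an ordering of the points, so that [s < t],
    [s = t] and [s > t] are treated alike. *)
Lemma mean_value_deriv_at (R : realType) (f g : R -> R) (a b s t : R) :
    (forall r, r \in `]a, b[ -> deriv_at f r (g r)) ->
    s \in `]a, b[ -> t \in `]a, b[ ->
  exists c, [/\ c \in `]a, b[, `|c - t| <= `|s - t| & f s - f t = g c * (s - t)].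
Proof.
move=> H sab tab.
have main u w : u \in `]a, b[ -> w \in `]a, b[ -> u < w ->
    exists c, [/\ c \in `]a, b[, u <= c <= w & f w - f u = g c * (w - u)].
  move=> uab wab uw.
  have sub c : u <= c <= w -> c \in `]a, b[.
    move: uab wab; rewrite !in_itv/= => /andP[au _] /andP[_ wb] /andP[uc cw].
    by rewrite (lt_le_trans au uc) (le_lt_trans cw wb).
  have [||c cuw e] := @MVT R f g u w uw.
  - move=> c; rewrite in_itv/= => /andP[uc cw].
    by apply: (H c); apply: sub; rewrite !ltW.
  - apply: derivable_within_continuous => c; rewrite in_itv/= => cuw.
    by apply: ex_derive; apply: (H c (sub c cuw)).
  move: cuw; rewrite in_itv/= => /andP[uc cw].
  by exists c; split=> //; [apply: sub|]; rewrite !ltW.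
have [st|ts|->] := ltgtP s t.
- have [c [cab /andP[sc ct] e]] := main s t sab tab st.
  exists c; split => //; last by rewrite -opprB e -mulrN opprB.
  by rewrite !ler0_norm ?subr_le0 ?(ltW st)// lerN2 lerD2r.
- have [c [cab /andP[tc cs] e]] := main t s tab sab ts.
  exists c; split => //.
  by rewrite !ger0_norm ?subr_ge0 ?(ltW ts)// lerD2r.
- by exists t; split => //; rewrite !subrr mulr0.
Qed.

(** Near a point of an open subinterval of [I], the difference quotient restricted to [I] is the
    full one. *)
Lemma lorenz_trajectory_deriv (R : realType) (theta : 'rV[R]_3) (I : set R)
    (X : R -> 'rV[R]_3) (a b t : R) (i : 'I_3) :
    lorenz_trajectory theta I X -> `]a, b[ `<=` I -> t \in `]a, b[ ->
  deriv_at (fun s => X s 0 i) t (lorenz_field theta (X t) 0 i).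
Proof.
move=> H abI tab; have It : I t by apply: abI.
have := H t It => c.
have ci := cvg_comp _ _ c (@coord_continuous R 1 3 0 i (lorenz_field theta (X t))).
apply: deriv_at_eps => e e0.
move/cvgrPdist_lt : ci => /(_ e e0) [r /= r0 hr].
have [r' /= r'0 hr'] := near_in_itvoo tab.
exists (Num.min r r'); first by rewrite lt_min r0.
move=> s st; rewrite lt_min => /andP[sr sr'].
rewrite distrC; have := hr s; rewrite /= !mxE; apply => //; first by rewrite distrC.
by apply: abI; apply: hr'; rewrite /= distrC.
Qed.

(** If the absolute value of [f t] exceeded the essential supremum, by continuity the same would
    hold on a neighbourhood of [t] inside [I], which has positive measure. *)
Lemma le_Linfty_norm (R : realType) (I : set R) (f : R -> R) (a b t : R) :
    `]a, b[ `<=` I -> (forall s, s \in `]a, b[ -> {for s, continuous f}) ->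
    t \in `]a, b[ ->
  (`|f t|%:E <= Linfty_norm I f)%E.
Proof.
move=> abI fc tab; rewrite /Linfty_norm unlock /=.
(* The norm of exponent [+oo] is the essential supremum once the whole space has positive
   measure. *)
have mu0 : (0 < @lebesgue_measure R [set: R])%E.
  apply: (@lt_le_trans _ _ (lebesgue_measure `[(0 : R), 1]%classic)).
    by rewrite lebesgue_measure_itv/= lte_fin ltr01 oppr0 adde0 lte_fin.
  by apply: le_measure; rewrite ?inE.
rewrite mu0 leNgt; apply/negP => lt.
have := ess_sup_ge (@lebesgue_measure R) (abse \o (EFin \o f \_ I)).
set E := ess_sup _ _ in lt * => -[A [mA A0 sub]].
have [r r0 hr] : exists2 r : R, 0 < r &
    forall s, `|s - t| < r -> (s \in `]a, b[) /\ (E < `|f s|%:E)%E.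
  have : \forall s \near t, (E < `|f s|%:E)%E.
    have fct : `|f s| @[s --> t] --> `|f t| by apply: cvg_norm; exact: fc.
    move: E lt {sub} => [E|//|_]; last by near=> s; rewrite ltNyr.
    rewrite lte_fin => lt; near=> s; rewrite lte_fin; near: s.
    exact: (cvgr_gt _ fct).
  move=> [r /= r0 hr]; have [r' /= r'0 hr'] := near_in_itvoo tab.
  exists (Num.min r r'); first by rewrite lt_min r0.
  move=> s; rewrite lt_min => /andP[sr sr']; split.
    by apply: hr'; rewrite /= distrC.
  by apply: hr; rewrite /= distrC.
pose J : set R := `](t - r), (t + r)[%classic.
have mJ : measurable J by exact: measurable_itv.
have : (@lebesgue_measure R J <= @lebesgue_measure R A)%E.
  apply: le_measure; rewrite ?inE// => s; rewrite /J /= in_itv/= => /andP[s1 s2].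
  have [sab Es] := hr s ltac:(rewrite ltr_distl; apply/andP; split; lra).
  apply: sub => /= h; move: Es; apply/negP; rewrite -leNgt.
  by rewrite patchE ifT ?inE in h => //; apply: abI.
rewrite A0 /J lebesgue_measure_itv/= lte_fin ifT; last by lra.
by rewrite lee_fin; lra.
Unshelve. all: by end_near. Qed.

(** * Ultrafilter limits of uniformly Lipschitz families *)

(** A cluster point of an ultrafilter is a limit. Thus one ultrafilter makes all the sequences below
    converge at every time at once, without extracting subsequences. *)
Lemma ultra_compact_cvg (T : topologicalType) (F : set_system nat) (A : set T)
    (u : nat -> T) :
    UltraFilter F -> compact A -> (forall n, A (u n)) ->
  exists2 p, A p & u n @[n --> F] --> p.
Proof.
move=> FU cA Au; have FP : ProperFilter F by exact: ultra_proper.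
have FA : (u @ F) A by apply: (@filterS _ F _ setT) => [n _|]; [exact: Au|exact: filterT].
have [p [Ap clp]] := cA (u @ F) _ FA.
exists p => // B nB.
have [//|h] := in_ultra_setVsetC (u @^-1` B) FU.
have [q [nq Bq]] := clp (~` B) B h nB.
by case: nq.
Qed.

Lemma ultra_bounded_cvg (R : realType) (F : set_system nat) (u : nat -> R) (M : R) :
    UltraFilter F -> (forall n, `|u n| <= M) ->
  exists l : R, u n @[n --> F] --> l.
Proof.
move=> FU uM; have [||l _ ul] := @ultra_compact_cvg R F `[- M, M] u FU.
- exact: segment_compact.
- by move=> n; rewrite /= in_itv/= -ler_norml.
- by exists l.
Qed.

Lemma cvg_le_bound (R : realType) (T : Type) (F : set_system T) (u : T -> R) (l c : R) :
    ProperFilter F -> u n @[n --> F] --> l -> (forall n, u n <= c) -> l <= c.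
Proof.
move=> FF ul uc; rewrite -(cvg_lim _ ul)//.
by apply: limr_le; [apply/cvg_ex; exists l|exact: nearW].
Qed.

Lemma cvg_ge_bound (R : realType) (T : Type) (F : set_system T) (u : T -> R) (l c : R) :
    ProperFilter F -> u n @[n --> F] --> l -> (forall n, c <= u n) -> c <= l.
Proof.
move=> FF ul uc; rewrite -(cvg_lim _ ul)//.
by apply: limr_ge; [apply/cvg_ex; exists l|exact: nearW].
Qed.

Lemma normM_le (R : realType) (u v A B : R) :
  `|u| <= A -> `|v| <= B -> `|u * v| <= A * B.
Proof. by move=> uA vB; rewrite normrM ler_pM. Qed.

Definition equibounded (R : realType) (a b : R) (f : nat -> R -> R) : Prop :=
  exists M, forall n t, t \in `]a, b[ -> `|f n t| <= M.

(** The constants are uniform in [n]. Stability under sums, opposites and products passes the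
    property to the right-hand sides of the equations, as [deriv_at_limit] requires. *)
Definition equilipschitz (R : realType) (a b : R) (f : nat -> R -> R) : Prop :=
  equibounded a b f /\ exists M, forall n s t, s \in `]a, b[ -> t \in `]a, b[ ->
    `|f n s - f n t| <= M * `|s - t|.

Lemma equiboundedD (R : realType) (a b : R) (f g : nat -> R -> R) :
  equibounded a b f -> equibounded a b g -> equibounded a b (fun n t => f n t + g n t).
Proof.
move=> [A fA] [B gB]; exists (A + B) => n t tab.
by rewrite (le_trans (ler_normD _ _))// lerD// ?fA ?gB.
Qed.

Lemma equiboundedN (R : realType) (a b : R) (f : nat -> R -> R) :
  equibounded a b f -> equibounded a b (fun n t => - f n t).
Proof. by move=> [A fA]; exists A => n t tab; rewrite normrN fA. Qed.

Lemma equiboundedM (R : realType) (a b : R) (f g : nat -> R -> R) :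
  equibounded a b f -> equibounded a b g -> equibounded a b (fun n t => f n t * g n t).
Proof.
move=> [A fA] [B gB]; exists (A * B) => n t tab.
by rewrite normM_le ?fA ?gB.
Qed.

Lemma equilipschitzD (R : realType) (a b : R) (f g : nat -> R -> R) :
    equilipschitz a b f -> equilipschitz a b g ->
  equilipschitz a b (fun n t => f n t + g n t).
Proof.
move=> [fb [A fA]] [gb [B gB]]; split; first exact: equiboundedD.
exists (A + B) => n s t sab tab.
rewrite opprD addrACA mulrDl (le_trans (ler_normD _ _))//.
by rewrite lerD// ?fA ?gB.
Qed.

Lemma equilipschitzN (R : realType) (a b : R) (f : nat -> R -> R) :
  equilipschitz a b f -> equilipschitz a b (fun n t => - f n t).
Proof.
move=> [fb [A fA]]; split; first exact: equiboundedN.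
by exists A => n s t sab tab; rewrite -opprD normrN fA.
Qed.

Lemma equilipschitzM (R : realType) (a b : R) (f g : nat -> R -> R) :
    equilipschitz a b f -> equilipschitz a b g ->
  equilipschitz a b (fun n t => f n t * g n t).
Proof.
move=> [fb [A fA]] [gb [B gB]]; split; first exact: equiboundedM.
move: fb gb => [A' fA'] [B' gB'].
exists (A' * B + A * B') => n s t sab tab.
have -> : f n s * g n s - f n t * g n t
  = f n s * (g n s - g n t) + (f n s - f n t) * g n t by ring.
set D := `|s - t|.
have -> : (A' * B + A * B') * D = A' * (B * D) + A * D * B' by ring.
rewrite (le_trans (ler_normD _ _))//.
by rewrite lerD// normM_le ?fA ?gB ?fA' ?gB'.
Qed.

Lemma equilipschitz_cst (R : realType) (a b M : R) (u : nat -> R) :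
  (forall n, `|u n| <= M) -> equilipschitz a b (fun n _ => u n).
Proof.
move=> uM; split; first by exists M.
by exists 0 => n s t _ _; rewrite subrr normr0 mul0r.
Qed.

Lemma deriv_at_lipschitz (R : realType) (f g : R -> R) (a b M : R) :
    (forall t, t \in `]a, b[ -> deriv_at f t (g t)) ->
    (forall t, t \in `]a, b[ -> `|g t| <= M) ->
  forall s t, s \in `]a, b[ -> t \in `]a, b[ -> `|f s - f t| <= M * `|s - t|.
Proof.
move=> fg gM s t sab tab.
have [c [cab _ ->]] := mean_value_deriv_at fg sab tab.
by rewrite normrM ler_wpM2r// gM.
Qed.

Lemma equilipschitz_deriv (R : realType) (a b : R) (f g : nat -> R -> R) :
    (forall n t, t \in `]a, b[ -> deriv_at (f n) t (g n t)) ->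
    equibounded a b f -> equibounded a b g ->
  equilipschitz a b f.
Proof.
move=> fg fb [M gM]; split => //; exists M => n.
exact: (deriv_at_lipschitz (fg n) (gM n)).
Qed.

(** By the mean value theorem and the common Lipschitz constant of the [g n], the first-order
    remainders of the [f n] are bounded by a fixed multiple of [(s - t) ^+ 2]; this bound passes to
    the pointwise limit. *)
Lemma deriv_at_limit (R : realType) (F : set_system nat) (a b : R)
    (f g : nat -> R -> R) (l m : R -> R) :
    UltraFilter F ->
    (forall n t, t \in `]a, b[ -> deriv_at (f n) t (g n t)) ->
    equilipschitz a b g ->
    (forall t, t \in `]a, b[ -> f n t @[n --> F] --> l t) ->
    (forall t, t \in `]a, b[ -> g n t @[n --> F] --> m t) ->
  forall t, t \in `]a, b[ -> deriv_at l t (m t).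
Proof.
move=> FU fg [_ [M gM]] fl gm t tab; have FP : ProperFilter F by exact: ultra_proper.
apply: (deriv_at_quadratic (M := `|M|) tab) => s sab.
have c : `|f n s - f n t - (s - t) * g n t| @[n --> F]
    --> `|l s - l t - (s - t) * m t|.
  apply: cvg_norm; apply: cvgB; first by apply: cvgB; apply: fl.
  by apply: cvgM; [exact: cvg_cst|exact: gm].
apply: (cvg_le_bound FP c) => n.
have [r [rab rst ->]] := mean_value_deriv_at (fg n) sab tab.
have -> : g n r * (s - t) - (s - t) * g n t = (g n r - g n t) * (s - t) by ring.
rewrite normrM -(real_normK (num_real (s - t))) expr2 mulrA ler_wpM2r//.
rewrite (le_trans (gM n r t rab tab))//.
apply: (@le_trans _ _ (`|M| * `|r - t|)); first by rewrite ler_wpM2r ?ler_norm.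
by rewrite ler_wpM2l.
Qed.

(** * Differences of two Lorenz trajectories and their rescaled limits *)

(** An absorption argument: with [S] the supremum of [m], the three derivatives are bounded by
    [L * (S + P)], so on a short interval [S <= m c + (S + P) / 2], and [S] can be absorbed on the
    left. *)
Lemma lorenz_difference_le (R : realType) (a b c T K : R)
    (s1 r1 b1 s2 r2 b2 : R) (x1 y1 z1 x2 y2 z2 : R -> R) :
    let P := `|s1 - s2| + `|r1 - r2| + `|b1 - b2| in
    let m t := `|x1 t - x2 t| + `|y1 t - y2 t| + `|z1 t - z2 t| in
    c \in `]a, b[ ->
    lorenz_on a b s1 r1 b1 x1 y1 z1 -> lorenz_on a b s2 r2 b2 x2 y2 z2 ->
    `|s1| <= T -> `|r1| <= T -> `|b1| <= T ->
    (forall t, t \in `]a, b[ ->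
      [/\ `|x1 t| <= K, `|y1 t| <= K & `|z1 t| <= K]) ->
    (forall t, t \in `]a, b[ ->
      [/\ `|x2 t| <= K, `|y2 t| <= K & `|z2 t| <= K]) ->
    6 * (T + 2 * K + 1) * (b - a) <= 1 ->
  forall t, t \in `]a, b[ -> m t <= 2 * (P + m c).
Proof.
move=> P m cab H1 H2 s1T r1T b1T B1 B2 ab.
pose A := [set m t | t in `]a, b[%classic]; pose S := sup A.
have K0 : 0 <= K by have [h _ _] := B1 c cab; exact: le_trans h.
have T0 : 0 <= T by exact: le_trans s1T.
have Aub : has_ubound A.
  exists (6 * K) => _ [t /= tab <-]; have [? ? ?] := B1 t tab.
  have [? ? ?] := B2 t tab; rewrite /m.
  have h (u v : R) : `|u| <= K -> `|v| <= K -> `|u - v| <= 2 * K.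
    move=> uK vK; rewrite (le_trans (ler_normB _ _))//; lra.
  have -> : 6 * K = 2 * K + 2 * K + 2 * K by ring.
  by rewrite !lerD// h.
have mS t : t \in `]a, b[ -> m t <= S.
  by move=> tab; apply: ub_le_sup => //; exists t.
have m0 t : 0 <= m t by rewrite /m !addr_ge0.
have S0 : 0 <= S by exact: le_trans (m0 c) (mS c cab).
have P0 : 0 <= P by rewrite /P !addr_ge0.
pose L := T + 2 * K + 1.
have L0 : 0 <= L by rewrite /L; lra.
have step t : t \in `]a, b[ -> m t <= m c + (S + P) / 2.
  move=> tab.
  have dist : `|t - c| <= b - a.
    move: tab cab; rewrite !in_itv/= => /andP[? ?] /andP[? ?].
    by rewrite ler_distl; apply/andP; split; lra.
  have bnd (f g : R -> R) : (forall t, t \in `]a, b[ -> deriv_at f t (g t)) ->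
      (forall t, t \in `]a, b[ -> `|g t| <= L * (S + P)) ->
      `|f t| <= `|f c| + L * (S + P) * (b - a).
    move=> fg gL; rewrite -[f t](subrKC (f c)).
    rewrite (le_trans (ler_normD _ _))// lerD2l.
    rewrite (le_trans (deriv_at_lipschitz fg gL tab cab))//.
    by rewrite ler_wpM2l// mulr_ge0// addr_ge0.
  have dx : `|x1 t - x2 t| <= `|x1 c - x2 c| + L * (S + P) * (b - a).
    apply: (bnd (fun t => x1 t - x2 t)
      (fun t => s1 * (y1 t - x1 t) - s2 * (y2 t - x2 t))) => r rab.
      have [x1d _ _ _] := H1 r rab; have [x2d _ _ _] := H2 r rab.
      by apply: deriv_at_eq; [derive_tac|].
    have [? ? ?] := B2 r rab; have := mS r rab; rewrite /m => mr.
    (* Here and for the other coordinates, each term pairs a coordinate or parameter difference with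
       a factor bounded by [T], [K] or 1. *)
    have -> : s1 * (y1 r - x1 r) - s2 * (y2 r - x2 r)
      = s1 * (y1 r - y2 r) + s1 * (- (x1 r - x2 r)) + (s1 - s2) * y2 r
        + (s1 - s2) * (- x2 r) by ring.
    apply: (@le_trans _ _ (T * `|y1 r - y2 r| + T * `|x1 r - x2 r|
      + `|s1 - s2| * K + `|s1 - s2| * K)).
      rewrite (le_trans (ler_normD _ _))// lerD//; last first.
        by rewrite normM_le// normrN.
      rewrite (le_trans (ler_normD _ _))// lerD//; last by rewrite normM_le.
      rewrite (le_trans (ler_normD _ _))// lerD//; first by rewrite normM_le.
      by rewrite normM_le// normrN.
    have e1 : T * `|y1 r - y2 r| + T * `|x1 r - x2 r| <= T * S.
      rewrite -mulrDr ler_wpM2l//; have := normr_ge0 (z1 r - z2 r); lra.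
    have e2 : `|s1 - s2| * K <= P * K.
      by rewrite ler_wpM2r// /P -addrA lerDl addr_ge0.
    have : 0 <= K * S /\ 0 <= T * P by rewrite !mulr_ge0.
    by rewrite /L => -[? ?]; lra.
  have dy : `|y1 t - y2 t| <= `|y1 c - y2 c| + L * (S + P) * (b - a).
    apply: (bnd (fun t => y1 t - y2 t)
      (fun t => x1 t * (r1 - z1 t) - y1 t - (x2 t * (r2 - z2 t) - y2 t))) => r rab.
      have [x1d y1d _ _] := H1 r rab; have [_ y2d _ _] := H2 r rab.
      by apply: deriv_at_eq; [derive_tac|].
    have [? ? ?] := B2 r rab; have [? ? ?] := B1 r rab.
    have := mS r rab; rewrite /m => mr.
    have -> : x1 r * (r1 - z1 r) - y1 r - (x2 r * (r2 - z2 r) - y2 r)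
      = r1 * (x1 r - x2 r) + - z1 r * (x1 r - x2 r)
        + x2 r * (r1 - r2) + - x2 r * (z1 r - z2 r) + - (y1 r - y2 r) by ring.
    apply: (@le_trans _ _ (T * `|x1 r - x2 r| + K * `|x1 r - x2 r|
      + K * `|r1 - r2| + K * `|z1 r - z2 r| + `|y1 r - y2 r|)).
      rewrite (le_trans (ler_normD _ _))// lerD//; last by rewrite normrN.
      rewrite (le_trans (ler_normD _ _))// lerD//; last by rewrite normM_le ?normrN.
      rewrite (le_trans (ler_normD _ _))// lerD//; last by rewrite normM_le.
      by rewrite (le_trans (ler_normD _ _))// lerD// normM_le// normrN.
    have e1 : T * `|x1 r - x2 r| <= T * S.
      rewrite ler_wpM2l//; have := normr_ge0 (z1 r - z2 r).
      have := normr_ge0 (y1 r - y2 r); lra.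
    have e2 : K * `|r1 - r2| <= K * P.
      by rewrite ler_wpM2l// /P -addrA addrCA lerDl addr_ge0.
    have e3 : K * `|x1 r - x2 r| + K * `|z1 r - z2 r| <= K * S.
      rewrite -mulrDr ler_wpM2l//; have := normr_ge0 (y1 r - y2 r); lra.
    have e4 : `|y1 r - y2 r| <= S.
      have := normr_ge0 (x1 r - x2 r); have := normr_ge0 (z1 r - z2 r); lra.
    have : 0 <= K * S /\ 0 <= T * P by rewrite !mulr_ge0.
    have : 0 <= K * P by rewrite mulr_ge0.
    by rewrite /L => ? [? ?]; lra.
  have dz : `|z1 t - z2 t| <= `|z1 c - z2 c| + L * (S + P) * (b - a).
    apply: (bnd (fun t => z1 t - z2 t)
      (fun t => x1 t * y1 t - b1 * z1 t - (x2 t * y2 t - b2 * z2 t))) => r rab.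
      have [_ _ z1d _] := H1 r rab; have [_ _ z2d _] := H2 r rab.
      by apply: deriv_at_eq; [derive_tac|].
    have [? ? ?] := B2 r rab; have [? ? ?] := B1 r rab.
    have := mS r rab; rewrite /m => mr.
    have -> : x1 r * y1 r - b1 * z1 r - (x2 r * y2 r - b2 * z2 r)
      = y1 r * (x1 r - x2 r) + x2 r * (y1 r - y2 r)
        + - b1 * (z1 r - z2 r) + - z2 r * (b1 - b2) by ring.
    apply: (@le_trans _ _ (K * `|x1 r - x2 r| + K * `|y1 r - y2 r|
      + T * `|z1 r - z2 r| + K * `|b1 - b2|)).
      rewrite (le_trans (ler_normD _ _))// lerD//; last by rewrite normM_le ?normrN.
      rewrite (le_trans (ler_normD _ _))// lerD//; last by rewrite normM_le ?normrN.
      by rewrite (le_trans (ler_normD _ _))// lerD// normM_le.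
    have e1 : T * `|z1 r - z2 r| <= T * S.
      rewrite ler_wpM2l//; have := normr_ge0 (x1 r - x2 r).
      have := normr_ge0 (y1 r - y2 r); lra.
    have e2 : K * `|b1 - b2| <= K * P.
      by rewrite ler_wpM2l// /P lerDr addr_ge0.
    have e3 : K * `|x1 r - x2 r| + K * `|y1 r - y2 r| <= K * S.
      rewrite -mulrDr ler_wpM2l//; have := normr_ge0 (z1 r - z2 r); lra.
    have : 0 <= K * S /\ 0 <= T * P by rewrite !mulr_ge0.
    have : 0 <= K * P by rewrite mulr_ge0.
    by rewrite /L => ? [? ?]; lra.
  have e : 6 * L * (b - a) * (S + P) <= 1 * (S + P).
    by rewrite ler_wpM2r// addr_ge0.
  rewrite /m; lra.
have : S <= m c + (S + P) / 2.
  apply: ge_sup; first by exists (m c), c.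
  by move=> _ [t tab <-]; apply: step.
move=> h t tab; have := mS t tab; have := m0 c; lra.
Qed.

(** The differences divided by [N n] have total size 1 at [c], while their first component tends to
    0. Their limit along [F] solves the linearised system with zero first component, so it vanishes,
    against the normalisation. *)
Lemma lorenz_no_degenerate_sequence (R : realType) (F : set_system nat)
    (a b c delta T K : R) (s1 r1 b1 s2 r2 b2 N : nat -> R)
    (x1 y1 z1 x2 y2 z2 : nat -> R -> R) :
    UltraFilter F -> \oo `<=` F -> c \in `]a, b[ -> 0 < delta ->
    (forall n, [/\ `|s1 n| <= T, `|r1 n| <= T & `|b1 n| <= T]) ->
    (forall n, [/\ `|s2 n| <= T, `|r2 n| <= T & `|b2 n| <= T]) ->
    (forall u, u = s1 \/ u = b1 \/ u = s2 \/ u = b2 ->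
       forall l : R, u n @[n --> F] --> l -> 0 < l) ->
    (forall n, lorenz_on a b (s1 n) (r1 n) (b1 n) (x1 n) (y1 n) (z1 n)) ->
    (forall n, lorenz_on a b (s2 n) (r2 n) (b2 n) (x2 n) (y2 n) (z2 n)) ->
    (forall n t, t \in `]a, b[ ->
      [/\ `|x1 n t| <= K, `|y1 n t| <= K & `|z1 n t| <= K]) ->
    (forall n t, t \in `]a, b[ ->
      [/\ `|x2 n t| <= K, `|y2 n t| <= K & `|z2 n t| <= K]) ->
    (forall n t, t \in `]a, b[ ->
      [/\ delta <= `|x2 n t|, delta <= `|y2 n t - x2 n t| & delta <= `|z2 n t|]) ->
    6 * (T + 2 * K + 1) * (b - a) <= 1 ->
    (forall n, N n = (`|s1 n - s2 n| + `|r1 n - r2 n| + `|b1 n - b2 n|)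
      + (`|x1 n c - x2 n c| + `|y1 n c - y2 n c| + `|z1 n c - z2 n c|)) ->
    (forall n, 0 < N n) ->
    (forall n t, t \in `]a, b[ -> `|x1 n t - x2 n t| <= N n * n.+1%:R^-1) ->
  False.
Proof.
move=> FU oF cab delta0 T1 T2 pos H1 H2 B1 B2 D small NE N0 xsmall.
have FP : ProperFilter F by exact: ultra_proper.
have ab : a < b by move: cab; rewrite in_itv/= => /andP[]; exact: lt_trans.
have Nn n : N n != 0 by rewrite gt_eqF.
pose ds n := (s1 n - s2 n) / N n.
pose dr n := (r1 n - r2 n) / N n.
pose db n := (b1 n - b2 n) / N n.
pose ex n t := (x1 n t - x2 n t) * (N n)^-1.
pose ey n t := (y1 n t - y2 n t) * (N n)^-1.
pose ez n t := (z1 n t - z2 n t) * (N n)^-1.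
have normN n (u : R) : `|u / N n| = `|u| / N n.
  by rewrite normrM normfV (gtr0_norm (N0 n)).
have total n : `|ds n| + `|dr n| + `|db n|
    + (`|ex n c| + `|ey n c| + `|ez n c|) = 1.
  by rewrite !normN -!mulrDl -NE divff.
have Dle n : [/\ `|ds n| <= 1, `|dr n| <= 1 & `|db n| <= 1].
  have := total n; have := normr_ge0 (ds n); have := normr_ge0 (dr n).
  have := normr_ge0 (db n); have := normr_ge0 (ex n c).
  have := normr_ge0 (ey n c); have := normr_ge0 (ez n c).
  by move=> *; split; lra.
(* The difference estimate spreads the bound at [c] over the whole interval. *)
have Ele n t : t \in `]a, b[ -> `|ex n t| + `|ey n t| + `|ez n t| <= 2.
  move=> tab; rewrite !normN -!mulrDl ler_pdivrMr// NE.
  have [? ? ?] := T1 n.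
  exact: (lorenz_difference_le cab (H1 n) (H2 n) _ _ _ (B1 n) (B2 n) small tab).
(* These equations are exact, each difference of products being split with one factor from each
   trajectory. So [N n] may stay away from 0, and the limit system pairs [s1o] and [b1o] with the
   second trajectory. *)
have exd n t : t \in `]a, b[ -> deriv_at (ex n) t
    (s1 n * (ey n t - ex n t) + ds n * (y2 n t - x2 n t)).
  move=> tab; have [x1d y1d z1d _] := H1 n t tab.
  have [x2d y2d z2d _] := H2 n t tab.
  apply: deriv_at_eq; first by derive_tac.
  by rewrite /= /ex /ey /ds; field.
have eyd n t : t \in `]a, b[ -> deriv_at (ey n) t
    (ex n t * (r1 n - z1 n t) + x2 n t * (dr n - ez n t) - ey n t).
  move=> tab; have [x1d y1d z1d _] := H1 n t tab.
  have [x2d y2d z2d _] := H2 n t tab.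
  apply: deriv_at_eq; first by derive_tac.
  by rewrite /= /ex /ey /ez /dr; field.
have ezd n t : t \in `]a, b[ -> deriv_at (ez n) t
    (ex n t * y1 n t + x2 n t * ey n t - b1 n * ez n t - db n * z2 n t).
  move=> tab; have [x1d y1d z1d _] := H1 n t tab.
  have [x2d y2d z2d _] := H2 n t tab.
  apply: deriv_at_eq; first by derive_tac.
  by rewrite /= /ex /ey /ez /db; field.
have Ls1 : equilipschitz a b (fun n _ => s1 n).
  by apply: (@equilipschitz_cst _ _ _ T) => n; case: (T1 n).
have Lr1 : equilipschitz a b (fun n _ => r1 n).
  by apply: (@equilipschitz_cst _ _ _ T) => n; case: (T1 n).
have Lb1 : equilipschitz a b (fun n _ => b1 n).
  by apply: (@equilipschitz_cst _ _ _ T) => n; case: (T1 n).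
have Ls2 : equilipschitz a b (fun n _ => s2 n).
  by apply: (@equilipschitz_cst _ _ _ T) => n; case: (T2 n).
have Lr2 : equilipschitz a b (fun n _ => r2 n).
  by apply: (@equilipschitz_cst _ _ _ T) => n; case: (T2 n).
have Lb2 : equilipschitz a b (fun n _ => b2 n).
  by apply: (@equilipschitz_cst _ _ _ T) => n; case: (T2 n).
have Lds : equilipschitz a b (fun n _ => ds n).
  by apply: (@equilipschitz_cst _ _ _ 1) => n; case: (Dle n).
have Ldr : equilipschitz a b (fun n _ => dr n).
  by apply: (@equilipschitz_cst _ _ _ 1) => n; case: (Dle n).
have Ldb : equilipschitz a b (fun n _ => db n).
  by apply: (@equilipschitz_cst _ _ _ 1) => n; case: (Dle n).
have bdx1 : equibounded a b x1 by exists K => n t /(B1 n)[].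
have bdy1 : equibounded a b y1 by exists K => n t /(B1 n)[].
have bdz1 : equibounded a b z1 by exists K => n t /(B1 n)[].
have bdx2 : equibounded a b x2 by exists K => n t /(B2 n)[].
have bdy2 : equibounded a b y2 by exists K => n t /(B2 n)[].
have bdz2 : equibounded a b z2 by exists K => n t /(B2 n)[].
have bex : equibounded a b ex.
  by exists 2 => n t /(Ele n); apply: le_trans; rewrite -addrA lerDl addr_ge0.
have bey : equibounded a b ey.
  by exists 2 => n t /(Ele n); apply: le_trans; rewrite -addrA addrCA lerDl addr_ge0.
have bez : equibounded a b ez.
  by exists 2 => n t /(Ele n); apply: le_trans; rewrite lerDr addr_ge0.
have Ly1 : equilipschitz a b y1.
  apply: (equilipschitz_deriv _ bdy1) => [n t /(H1 n)[_ d _ _]|]; first exact: d.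
  exact: (equiboundedD (equiboundedM bdx1 (equiboundedD Lr1.1 (equiboundedN bdz1)))
    (equiboundedN bdy1)).
have Lz1 : equilipschitz a b z1.
  apply: (equilipschitz_deriv _ bdz1) => [n t /(H1 n)[_ _ d _]|]; first exact: d.
  exact: (equiboundedD (equiboundedM bdx1 bdy1)
    (equiboundedN (equiboundedM Lb1.1 bdz1))).
have Lx2 : equilipschitz a b x2.
  apply: (equilipschitz_deriv _ bdx2) => [n t /(H2 n)[d _ _ _]|]; first exact: d.
  exact: (equiboundedM Ls2.1 (equiboundedD bdy2 (equiboundedN bdx2))).
have Ly2 : equilipschitz a b y2.
  apply: (equilipschitz_deriv _ bdy2) => [n t /(H2 n)[_ d _ _]|]; first exact: d.
  exact: (equiboundedD (equiboundedM bdx2 (equiboundedD Lr2.1 (equiboundedN bdz2)))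
    (equiboundedN bdy2)).
have Lz2 : equilipschitz a b z2.
  apply: (equilipschitz_deriv _ bdz2) => [n t /(H2 n)[_ _ d _]|]; first exact: d.
  exact: (equiboundedD (equiboundedM bdx2 bdy2)
    (equiboundedN (equiboundedM Lb2.1 bdz2))).
have Lex : equilipschitz a b ex.
  apply: (equilipschitz_deriv exd bex).
  exact: (equiboundedD (equiboundedM Ls1.1 (equiboundedD bey (equiboundedN bex)))
    (equiboundedM Lds.1 (equiboundedD bdy2 (equiboundedN bdx2)))).
have Ley : equilipschitz a b ey.
  apply: (equilipschitz_deriv eyd bey).
  exact: (equiboundedD (equiboundedD
    (equiboundedM bex (equiboundedD Lr1.1 (equiboundedN bdz1)))
    (equiboundedM bdx2 (equiboundedD Ldr.1 (equiboundedN bez)))) (equiboundedN bey)).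
have Lez : equilipschitz a b ez.
  apply: (equilipschitz_deriv ezd bez).
  exact: (equiboundedD (equiboundedD (equiboundedD (equiboundedM bex bdy1)
    (equiboundedM bdx2 bey)) (equiboundedN (equiboundedM Lb1.1 bez)))
    (equiboundedN (equiboundedM Ldb.1 bdz2))).
have limit (f : nat -> R -> R) : equilipschitz a b f ->
    exists l : R -> R, forall t, t \in `]a, b[ -> f n t @[n --> F] --> l t.
  move=> [[M fM] _].
  have /choice[l lP] t : exists l : R, t \in `]a, b[ -> f n t @[n --> F] --> l.
    have [tab|tab] := boolP (t \in `]a, b[); last by exists 0.
    have [l fl] := @ultra_bounded_cvg R F (fun n => f n t) M FU (fun n => fM n t tab).
    by exists l.
  by exists l.
have limitc (u : nat -> R) : equilipschitz a b (fun n _ => u n) ->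
    exists l : R, u n @[n --> F] --> l.
  by move=> /limit[l lP]; exists (l c); exact: lP.
have [s1o s1c] := limitc _ Ls1; have [r1o r1c] := limitc _ Lr1.
have [b1o b1c] := limitc _ Lb1; have [s2o s2c] := limitc _ Ls2.
have [r2o r2c] := limitc _ Lr2; have [b2o b2c] := limitc _ Lb2.
have [dso dsc] := limitc _ Lds; have [dro drc] := limitc _ Ldr.
have [dbo dbc] := limitc _ Ldb.
have [y1o y1c] := limit _ Ly1; have [z1o z1c] := limit _ Lz1.
have [x2o x2c] := limit _ Lx2; have [y2o y2c] := limit _ Ly2.
have [z2o z2c] := limit _ Lz2; have [exo exc] := limit _ Lex.
have [eyo eyc] := limit _ Ley; have [ezo ezc] := limit _ Lez.
have exo0 t : t \in `]a, b[ -> exo t = 0.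
  move=> tab; apply/eqP; rewrite -normr_le0.
  (* [F] refines [\oo], so ordinary limits are limits along [F]. *)
  have h0 : n.+1%:R^-1 @[n --> F] --> (0 : R).
    by apply: cvg_trans (@cvg_harmonic R); exact: cvg_app.
  have h : `|ex n t| - n.+1%:R^-1 @[n --> F] --> `|exo t|.
    rewrite -[X in _ --> X]subr0; apply: cvgB => //.
    by apply: cvg_norm; exact: exc.
  apply: (cvg_le_bound FP h) => n.
  by rewrite subr_le0 normN ler_pdivrMr// mulrC xsmall.
have Hlim : lorenz_on a b s2o r2o b2o x2o y2o z2o.
  move=> t tab; split.
  - apply: (deriv_at_limit FU (f := x2) (m := fun t => s2o * (y2o t - x2o t)))
      (tab) => //; first by move=> n r /(H2 n)[d _ _ _]; exact: d.
      exact: (equilipschitzM Ls2 (equilipschitzD Ly2 (equilipschitzN Lx2))).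
    by move=> r rab; apply: cvgM => //; apply: cvgB; [exact: y2c|exact: x2c].
  - apply: (deriv_at_limit FU (f := y2)
      (m := fun t => x2o t * (r2o - z2o t) - y2o t)) (tab) => //;
      first by move=> n r /(H2 n)[_ d _ _]; exact: d.
      exact: (equilipschitzD (equilipschitzM Lx2
        (equilipschitzD Lr2 (equilipschitzN Lz2))) (equilipschitzN Ly2)).
    move=> r rab; apply: cvgB; last exact: y2c.
    by apply: cvgM; [exact: x2c|apply: cvgB => //; exact: z2c].
  - apply: (deriv_at_limit FU (f := z2)
      (m := fun t => x2o t * y2o t - b2o * z2o t)) (tab) => //;
      first by move=> n r /(H2 n)[_ _ d _]; exact: d.
      exact: (equilipschitzD (equilipschitzM Lx2 Ly2)
        (equilipschitzN (equilipschitzM Lb2 Lz2))).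
    move=> r rab; apply: cvgB; first by apply: cvgM; [exact: x2c|exact: y2c].
    by apply: cvgM => //; exact: z2c.
  - have far (u : nat -> R) (l : R) : u n @[n --> F] --> l ->
        (forall n, delta <= `|u n|) -> l != 0.
      move=> ul du; rewrite -normr_gt0 (lt_le_trans delta0)//.
      exact: (cvg_ge_bound FP (cvg_norm ul) du).
    split.
    + by apply: far (x2c t tab) _ => n; case: (D n t tab).
    + rewrite -subr_eq0; apply: far (cvgB (y2c t tab) (x2c t tab)) _ => n.
      by case: (D n t tab).
    + by apply: far (z2c t tab) _ => n; case: (D n t tab).
have Elim t : t \in `]a, b[ ->
    [/\ s1o * eyo t + dso * (y2o t - x2o t) = 0,
        deriv_at eyo t (x2o t * (dro - ezo t) - eyo t) &
        deriv_at ezo t (x2o t * eyo t - b1o * ezo t - dbo * z2o t)].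
  move=> tab; split.
  (* As [exo] vanishes on the whole interval, so does its derivative, and the first equation becomes
     algebraic. *)
  - have : deriv_at exo t (s1o * (eyo t - exo t) + dso * (y2o t - x2o t)).
      apply: (deriv_at_limit FU (f := ex)
        (m := fun t => s1o * (eyo t - exo t) + dso * (y2o t - x2o t)) exd) (tab) => //.
        exact: (equilipschitzD (equilipschitzM Ls1
          (equilipschitzD Ley (equilipschitzN Lex))) (equilipschitzM Lds
          (equilipschitzD Ly2 (equilipschitzN Lx2)))).
      move=> r rab; apply: cvgD; apply: cvgM => //; apply: cvgB;
        [exact: eyc|exact: exc|exact: y2c|exact: x2c].
    move/(deriv_at_unique_itv tab exo0)/(_ (deriv_at_cst t 0)).
    by rewrite exo0// subr0.
  - have : deriv_at eyo t
        (exo t * (r1o - z1o t) + x2o t * (dro - ezo t) - eyo t).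
      apply: (deriv_at_limit FU (f := ey) (m := fun t =>
        exo t * (r1o - z1o t) + x2o t * (dro - ezo t) - eyo t) eyd) (tab) => //.
        exact: (equilipschitzD (equilipschitzD
          (equilipschitzM Lex (equilipschitzD Lr1 (equilipschitzN Lz1)))
          (equilipschitzM Lx2 (equilipschitzD Ldr (equilipschitzN Lez))))
          (equilipschitzN Ley)).
      move=> r rab; apply: cvgB; last exact: eyc.
      apply: cvgD; apply: cvgM; [exact: exc| |exact: x2c|].
        by apply: cvgB => //; exact: z1c.
      by apply: cvgB => //; exact: ezc.
    by rewrite exo0// mul0r add0r.
  - have : deriv_at ezo t
        (exo t * y1o t + x2o t * eyo t - b1o * ezo t - dbo * z2o t).
      apply: (deriv_at_limit FU (f := ez) (m := fun t =>
        exo t * y1o t + x2o t * eyo t - b1o * ezo t - dbo * z2o t) ezd) (tab) => //.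
        exact: (equilipschitzD (equilipschitzD (equilipschitzD
          (equilipschitzM Lex Ly1) (equilipschitzM Lx2 Ley))
          (equilipschitzN (equilipschitzM Lb1 Lez)))
          (equilipschitzN (equilipschitzM Ldb Lz2))).
      move=> r rab; apply: cvgB; last by apply: cvgM => //; exact: z2c.
      apply: cvgB; last by apply: cvgM => //; exact: ezc.
      by apply: cvgD; apply: cvgM; [exact: exc|exact: y1c|exact: x2c|exact: eyc].
    by rewrite exo0// mul0r add0r.
have [ds0 dr0 db0 e0] := linearized_lorenz_injective ab
  (pos s2 (or_intror (or_intror (or_introl erefl))) _ s2c)
  (pos b2 (or_intror (or_intror (or_intror erefl))) _ b2c)
  (pos s1 (or_introl erefl) _ s1c) (pos b1 (or_intror (or_introl erefl)) _ b1c)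
  Hlim Elim.
have [ey0 ez0] := e0 c cab.
(* The constant sum [total] passes to the limit, where every term is 0. *)
have h : (1 : R) @[_ --> F] --> `|dso| + `|dro| + `|dbo|
    + (`|exo c| + `|eyo c| + `|ezo c|).
  rewrite -(funext total).
  by repeat (apply: cvgD); apply: cvg_norm => //;
    [exact: exc|exact: eyc|exact: ezc].
have := cvg_ge_bound FP h (fun=> lexx 1).
by rewrite ds0 dr0 db0 exo0// ey0 ez0 !normr0 !addr0 ler10.
Qed.

(** * Coordinates, distance to [calS] and the choice of a sequence of counterexamples *)

Lemma enormE (R : realType) (p : 'rV[R]_3) :
  enorm p = Num.sqrt (p 0 0 ^+ 2 + p 0 1 ^+ 2 + p 0 2 ^+ 2).
Proof.
rewrite /enorm !big_ord_recl big_ord0 addr0 addrA.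
by congr (Num.sqrt (_ + p 0 _ ^+ 2 + p 0 _ ^+ 2)); apply: val_inj.
Qed.

Lemma coord_le_enorm (R : realType) (p : 'rV[R]_3) :
  [/\ `|p 0 0| <= enorm p, `|p 0 1| <= enorm p & `|p 0 2| <= enorm p].
Proof.
rewrite enormE -!sqrtr_sqr.
have := sqr_ge0 (p 0 0); have := sqr_ge0 (p 0 1); have := sqr_ge0 (p 0 2).
by move=> *; split; apply: ler_wsqrtr; lra.
Qed.

Lemma enorm_le_sum (R : realType) (p : 'rV[R]_3) :
  enorm p <= `|p 0 0| + `|p 0 1| + `|p 0 2|.
Proof.
set s := (X in _ <= X); have s0 : 0 <= s by rewrite /s !addr_ge0.
rewrite enormE -[leRHS]ger0_norm// -sqrtr_sqr; apply: ler_wsqrtr.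
rewrite /s -(real_normK (num_real (p 0 0))) -(real_normK (num_real (p 0 1))).
rewrite -(real_normK (num_real (p 0 2))).
have := normr_ge0 (p 0 0); have := normr_ge0 (p 0 1); have := normr_ge0 (p 0 2).
by move=> *; nra.
Qed.

Lemma vec3E (R : realType) (x y z : R) :
  [/\ vec3 x y z 0 0 = x, vec3 x y z 0 1 = y & vec3 x y z 0 2 = z].
Proof. by rewrite !mxE. Qed.

(** The distance from [p] to any point of [calS] is at least [delta]; the points used are the
    projections of [p] onto the three planes along a coordinate axis. For the plane [y = x] this
    projection is not orthogonal, but its distance is exactly that of [y] to [x]. *)
Lemma calS_delta_coords (R : realType) (delta : R) (p : 'rV[R]_3) :
    calS_delta delta p ->
  [/\ delta <= `|p 0 0|, delta <= `|p 0 1 - p 0 0| & delta <= `|p 0 2|].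
Proof.
rewrite /calS_delta /edistance /= => dp.
have le q : @calS R q -> delta <= enorm (p - q).
  move=> Sq; apply: (le_trans dp); apply: ge_inf; last by exists q.
  by exists 0 => _ [r _ <-]; apply: sqrtr_ge0.
split.
- have := le (vec3 0 (p 0 1) (p 0 2)); rewrite /calS /= /xcoord /ycoord /zcoord.
  have [e0 e1 e2] := vec3E 0 (p 0 1) (p 0 2); rewrite e0 e1 e2 => h.
  apply: (le_trans (h _)); first by right; left.
  rewrite enormE !mxE /= !subrr subr0 expr0n/= !addr0 sqrtr_sqr; exact: lexx.
- have := le (vec3 (p 0 0) (p 0 0) (p 0 2)); rewrite /calS /= /xcoord /ycoord /zcoord.
  have [e0 e1 e2] := vec3E (p 0 0) (p 0 0) (p 0 2); rewrite e0 e1 e2 => h.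
  apply: (le_trans (h _)); first by left.
  rewrite enormE !mxE /= !subrr expr0n/= addr0 add0r sqrtr_sqr; exact: lexx.
- have := le (vec3 (p 0 0) (p 0 1) 0); rewrite /calS /= /xcoord /ycoord /zcoord.
  have [e0 e1 e2] := vec3E (p 0 0) (p 0 1) 0; rewrite e0 e1 e2 => h.
  apply: (le_trans (h _)); first by right; right.
  rewrite enormE !mxE /= !subrr subr0 expr0n/= !add0r sqrtr_sqr; exact: lexx.
Qed.

Lemma lorenz_trajectory_on (R : realType) (theta : 'rV[R]_3) (I : set R)
    (X : R -> 'rV[R]_3) (a b delta : R) :
    0 < delta -> lorenz_trajectory theta I X -> `]a, b[ `<=` I ->
    (forall t, I t -> calS_delta delta (X t)) ->
  lorenz_on a b (theta 0 0) (theta 0 1) (theta 0 2)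
    (fun t => X t 0 0) (fun t => X t 0 1) (fun t => X t 0 2).
Proof.
move=> delta0 HX abI HS t tab.
have [e0 e1 e2] := vec3E (sigma theta * (ycoord (X t) - xcoord (X t)))
  (xcoord (X t) * (rho theta - zcoord (X t)) - ycoord (X t))
  (xcoord (X t) * ycoord (X t) - beta theta * zcoord (X t)).
split.
- by have := lorenz_trajectory_deriv 0 HX abI tab; rewrite /lorenz_field e0.
- by have := lorenz_trajectory_deriv 1 HX abI tab; rewrite /lorenz_field e1.
- by have := lorenz_trajectory_deriv 2 HX abI tab; rewrite /lorenz_field e2.
- have [h0 h1 h2] := calS_delta_coords (HS t (abI t tab)).
  by split; rewrite -?[_ == _ 0 0]subr_eq0 -normr_gt0 (lt_le_trans delta0).
Qed.

Lemma compact_coord_bounded (R : realType) (A : set 'rV[R]_3) : compact A ->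
  exists2 T : R, 0 <= T & forall p i, A p -> `|p 0 i| <= T.
Proof.
move=> /compact_bounded[M [_ hM]].
exists (`|M| + 1); first by rewrite addr_ge0.
move=> p i Ap; have := hM (`|M| + 1) _ p Ap; rewrite ltr_pwDr ?ler_norm//.
move=> /(_ erefl); apply: le_trans; rewrite [leRHS]mx_normrE.
exact: (@le_bigmax _ _ _ 0 (fun ij => `|p ij.1 ij.2|) (0, i)).
Qed.

Theorem theorem3 (R : realType) (delta K : R) (Theta_ad : set 'rV[R]_3)
    (I : set R)
    (delta_gt0 : 0 < delta) (K_gt0 : 0 < K)
    (Theta_compact : compact Theta_ad)
    (Theta_pos : forall theta, Theta_ad theta ->
       0 < sigma theta /\ 0 < beta theta)
    (I_itv : nontrivial_interval I) :
  exists2 C : R, 0 < C &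
    forall (theta1 theta2 : 'rV[R]_3) (X1 X2 : R -> 'rV[R]_3),
      Theta_ad theta1 -> Theta_ad theta2 ->
      lorenz_trajectory theta1 I X1 -> lorenz_trajectory theta2 I X2 ->
      (forall t, I t -> calS_delta delta (X1 t)) ->
      (forall t, I t -> calS_delta delta (X2 t)) ->
      (forall t, I t -> enorm (X1 t) <= K) ->
      (forall t, I t -> enorm (X2 t) <= K) ->
      (lies_on_attractor theta1 I X1 /\ lies_on_attractor theta2 I X2) \/
      (exists2 t0 : R, 0 < t0 & `[t0, +oo[ `<=` I) ->
      ((enorm (theta1 - theta2))%:E <=
         C%:E * Linfty_norm I (fun t => xcoord (X1 t) - xcoord (X2 t))%R)%E.
Proof.
have [a0 [b0 [a0b0 Ia0 Ib0]]] := I_itv.2.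
have [T T0 thT] := compact_coord_bounded Theta_compact.
pose L := 6 * (T + 2 * K + 1); have L0 : 0 < L by rewrite /L; lra.
(* The length is cut to at most [L^-1], as the difference estimate requires; the interval depends
   only on [I], [K] and [Theta_ad]. *)
pose a := a0; pose b := Num.min b0 (a0 + L^-1).
have ab : a < b by rewrite lt_min a0b0 ltrDl invr_gt0.
have small : L * (b - a) <= 1.
  rewrite -ler_pdivlMl// mulr1 lerBlDl ge_min; apply/orP; right; exact: lexx.
have abI : `]a, b[ `<=` I.
  move=> t; rewrite /= in_itv/= lt_min => /andP[at_ /andP[tb _]].
  by apply: (I_itv.1 _ _ Ia0 Ib0); rewrite !ltW.
pose c := (a + b) / 2.
have cab : c \in `]a, b[ by rewrite in_itv/= /c; apply/andP; split; lra.
apply: contrapT => noC.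
pose dist (w : ('rV[R]_3 * 'rV[R]_3) * ((R -> 'rV[R]_3) * (R -> 'rV[R]_3))) :=
  (`|w.1.1 0 0 - w.1.2 0 0| + `|w.1.1 0 1 - w.1.2 0 1| + `|w.1.1 0 2 - w.1.2 0 2|)
  + (`|w.2.1 c 0 0 - w.2.2 c 0 0| + `|w.2.1 c 0 1 - w.2.2 c 0 1|
     + `|w.2.1 c 0 2 - w.2.2 c 0 2|).
have /choice[w wP] n : exists w,
    [/\ Theta_ad w.1.1 /\ Theta_ad w.1.2,
        lorenz_trajectory w.1.1 I w.2.1 /\ lorenz_trajectory w.1.2 I w.2.2,
        (forall t, I t -> calS_delta delta (w.2.1 t)) /\
        (forall t, I t -> calS_delta delta (w.2.2 t)),
        (forall t, I t -> enorm (w.2.1 t) <= K) /\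
        (forall t, I t -> enorm (w.2.2 t) <= K) &
        0 < dist w /\ forall t, t \in `]a, b[ ->
          `|w.2.1 t 0 0 - w.2.2 t 0 0| <= dist w * n.+1%:R^-1].
  (* A failure of the constant [n.+1] provides [w]: on the short interval, [n.+1] times the
     first-coordinate difference is at most [n.+1] times the sup norm, hence less than the parameter
     distance and than [dist]. At [c] this also gives [0 < dist]. *)
  apply: contrapT => now; apply: noC; exists n.+1%:R => // theta1 theta2 X1 X2.
  move=> A1 A2 tr1 tr2 S1 S2 K1 K2 _; rewrite leNgt; apply/negP => lt.
  apply: now; exists ((theta1, theta2), (X1, X2)) => /=.
  have le t : t \in `]a, b[ ->
      n.+1%:R * `|X1 t 0 0 - X2 t 0 0| < dist ((theta1, theta2), (X1, X2)).
    move=> tab; rewrite -lte_fin.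
    apply: (@lt_le_trans _ _ (enorm (theta1 - theta2))%:E); last first.
      rewrite lee_fin (le_trans (enorm_le_sum _))// !mxE /dist /=.
      by rewrite lerDl !addr_ge0.
    apply: le_lt_trans lt; rewrite EFinM lee_wpmul2l// ?lee_fin//.
    apply: (le_Linfty_norm abI) tab => s sab.
    have [d1 _ _ _] := lorenz_trajectory_on delta_gt0 tr1 abI S1 sab.
    have [d2 _ _ _] := lorenz_trajectory_on delta_gt0 tr2 abI S2 sab.
    exact: (deriv_at_continuous (deriv_atD d1 (deriv_atN d2))).
  split=> //; split; first by apply: le_lt_trans (le c cab); rewrite mulr_ge0.
  by move=> t /le/ltW; rewrite ler_pdivlMr ?ltr0n// mulrC.
have [F [FU oF]] := @ultraFilterLemma nat \oo _.
have FP : ProperFilter F by exact: ultra_proper.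
(* Limits of admissible parameters are admissible by compactness, so [sigma] and [beta] stay
   strictly positive in the limit. *)
have limit_pos (th : nat -> 'rV[R]_3) : (forall n, Theta_ad (th n)) ->
    (forall l : R, th n 0 0 @[n --> F] --> l -> 0 < l) /\
    (forall l : R, th n 0 2 @[n --> F] --> l -> 0 < l).
  move=> thA; have [p Ap thp] := ultra_compact_cvg FU Theta_compact thA.
  have [s0 b0'] := Theta_pos p Ap.
  have coord (i : 'I_3) : th n 0 i @[n --> F] --> p 0 i.
    exact: (cvg_comp _ _ thp (@coord_continuous R 1 3 0 i p)).
  split=> l ll.
  - by rewrite (cvg_unique _ ll (coord 0)).
  - by rewrite (cvg_unique _ ll (coord 2)).
have A1 n : Theta_ad (w n).1.1 by have [[]] := wP n.
have A2 n : Theta_ad (w n).1.2 by have [[]] := wP n.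
have [p1s p1b] := limit_pos _ A1; have [p2s p2b] := limit_pos _ A2.
have coordsK (X : R -> 'rV[R]_3) t : (forall t, I t -> enorm (X t) <= K) ->
    t \in `]a, b[ -> [/\ `|X t 0 0| <= K, `|X t 0 1| <= K & `|X t 0 2| <= K].
  move=> XK tab; have [h0 h1 h2] := coord_le_enorm (X t).
  by split; apply: le_trans (XK t (abI t tab)).
apply: (@lorenz_no_degenerate_sequence R F a b c delta T K
  (fun n => (w n).1.1 0 0) (fun n => (w n).1.1 0 1) (fun n => (w n).1.1 0 2)
  (fun n => (w n).1.2 0 0) (fun n => (w n).1.2 0 1) (fun n => (w n).1.2 0 2)
  (fun n => dist (w n))
  (fun n t => (w n).2.1 t 0 0) (fun n t => (w n).2.1 t 0 1)
  (fun n t => (w n).2.1 t 0 2)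
  (fun n t => (w n).2.2 t 0 0) (fun n t => (w n).2.2 t 0 1)
  (fun n t => (w n).2.2 t 0 2)) => //.
- by move=> n; split; apply: thT.
- by move=> n; split; apply: thT.
- by move=> u [|[|[|]]] ->.
- move=> n; have [_ [tr1 tr2] [S1 S2] _ _] := wP n.
  exact: lorenz_trajectory_on delta_gt0 tr1 abI S1.
- move=> n; have [_ [tr1 tr2] [S1 S2] _ _] := wP n.
  exact: lorenz_trajectory_on delta_gt0 tr2 abI S2.
- by move=> n t tab; have [_ _ _ [K1 K2] _] := wP n; exact: coordsK.
- by move=> n t tab; have [_ _ _ [K1 K2] _] := wP n; exact: coordsK.
- move=> n t tab; have [_ _ [S1 S2] _ _] := wP n.
  exact: calS_delta_coords (S2 t (abI t tab)).
- by move=> n; have [_ _ _ _ []] := wP n.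
- by move=> n t tab; have [_ _ _ _ [_]] := wP n; apply.
Qed.
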